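(* For all real $x$ with $0\le x\le 3$, $x\neq 1$, $$p_3(x) = \frac{2\sqrt{3}}{\pi}\,\frac{x}{3+x^2}\; {}_2F_1\!\left(\tfrac13,\tfrac23;\,1;\,\frac{x^2(9-x^2)^2}{(3+x^2)^3}\right).$$
   Context: For an integer $n\ge 1$, $p_n$ denotes the (radial) probability density on $[0,\infty)$ of the distance from the origin, i.e. of $\left|\sum_{k=1}^n e^{2\pi i U_k}\right|$ with $U_1,\dots,U_n$ independent and uniform on $[0,1]$, after an $n$-step uniform random walk in the plane (each step of length $1$ in a uniformly random direction). The function $p_3$ is taken to be the version of the density that is continuous on $[0,1)\cup(1,3]$ (with the value at $3$ being the limit from the left). ${}_2F_1$ is the Gauss hypergeometric function. *)

(* Defs.v *)
From mathcomp Require Import all_boot all_order all_algebra.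
From mathcomp Require Import all_classical all_reals all_analysis.
From mathcomp Require Import complex.

Set Implicit Arguments.
Unset Strict Implicit.
Unset Printing Implicit Defensive.

Import Order.TTheory GRing.Theory Num.Theory.
Import numFieldNormedType.Exports.

Local Open Scope classical_set_scope.
Local Open Scope ring_scope.

(* The family is finite, so the product rule over all indices suffices: take
   A i = setT for the indices outside a given subfamily. *)
Definition mutually_independent (R : realType) (d : measure_display)
    (T : measurableType d) (P : probability T R) (n : nat)
    (X : 'I_n -> {RV P >-> R}) : Prop :=
  forall A : 'I_n -> set R, (forall i, measurable (A i)) ->
    P (\bigcap_(i in [set: 'I_n]) (X i @^-1` A i)) =
    (\prod_(i < n) P (X i @^-1` A i))%E.

Definition uniformly_distributed01 (R : realType) (d : measure_display)
    (T : measurableType d) (P : probability T R) (X : {RV P >-> R}) : Prop :=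
  forall A : set R, measurable A ->
    distribution P X A = uniform_prob (@ltr01 R) A.

Definition expi (R : realType) (t : R) : R[i] := (cos t +i* sin t)%C.

(* The norm of R[i] takes values in R[i], with zero imaginary part; complex.Re
   brings it back to R. *)
Definition walk_distance (R : realType) (d : measure_display)
    (T : measurableType d) (P : probability T R) (n : nat)
    (U : 'I_n -> {RV P >-> R}) (w : T) : R :=
  complex.Re `| \sum_(k < n) expi (2 * pi * U k w) |.

(* Only the values of p on [0, +oo[ matter. *)
Definition is_radial_density (R : realType) (d : measure_display)
    (T : measurableType d) (P : probability T R) (X : T -> R) (p : R -> R)
    : Prop :=
  [/\ measurable_fun (`[0, +oo[ : set R) p,
      forall x, 0 <= x -> 0 <= p x
    & forall A : set R, measurable A ->
        P (X @^-1` A) =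
        (\int[lebesgue_measure]_(x in A `&` `[0%R, +oo[) (p x)%:E)%E].

(* (a)_k = a (a + 1) ... (a + k - 1) *)
Definition pochhammer (R : realType) (a : R) (k : nat) : R :=
  \prod_(i < k) (a + i%:R).

(* Sum of the Gauss series; meaningful for `|z| < 1 and c not in {0, -1, ...}. *)
Definition hypergeometric2F1 (R : realType) (a b c z : R) : R :=
  limn (series (fun k : nat =>
    pochhammer a k * pochhammer b k / (pochhammer c k * k`!%:R) * z ^+ k)).

(* Main.v *)
From HB Require Import structures.
Require Import Defs.
From mathcomp Require Import all_boot all_order all_algebra.
From mathcomp Require Import all_classical all_reals all_analysis.
From mathcomp Require Import measurable_realfun complex ring lra.

Set Implicit Arguments.
Unset Strict Implicit.
Unset Printing Implicit Defensive.

Import Order.TTheory GRing.Theory Num.Theory.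
Import numFieldNormedType.Exports.

Local Open Scope classical_set_scope.
Local Open Scope ring_scope.

(** Let r be the distance from the origin after two of the three steps. By rotation invariance it is
    twice the cosine of a uniform angle, and the third step makes an independent uniform angle with the
    first two ([two_angles]). For fixed r the law of cosines gives the density of the third distance x
    ([integral_third_side]). After exchanging the integrals, the parametrization
    r^2 = 1 + x^2 + 2 x cos s, or for x > 1 a multiple of its analogue with (3 - x) / (1 + x) in place of
    x, turns the integral over r into the complete elliptic integral G(x) = [walk_integral x] of
    1 / sqrt ((1 + x^2 + 2 x cos s) (3 - x^2 - 2 x cos s)) over 0 < s < pi ([integral_second_step]).
    Both parametrizations give the same closed form, because the modulus x^2 (9 - x^2)^2 / (3 + x^2)^3
    is invariant under x -> (3 - x) / (1 + x) ([walk_gauss_involution]).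

    It remains to evaluate G on [0, 1). Both G and H(x) = 3 / (3 + x^2) 2F1(1/3, 2/3; 1; modulus) solve
      (x (9 - x^2) (1 - x^2) u')' = 4 x (3 - x^2) u :
    for G the difference of the two sides, under the integral sign, is the derivative in s of an explicit
    function that vanishes at 0 and pi ([walk_integral_equation]); for H this is Gauss' equation after a
    change of variable ([walk_gauss_equation]). The expression x (9 - x^2) (1 - x^2) (G H' - G' H) is
    therefore constant on (-1, 1), and it is 0 at 0. So G / H is constant, equal to G(0) = pi / sqrt 3
    ([walk_integralE]).

    Hence the closed form integrates, over every interval that avoids 1, to the probability that the
    distance lies in it ([walk_density_law]). So does the given density; both are continuous on
    [0, 1) and (1, 3], and they coincide there ([le_of_integral_eq]). *)

(** * The Gauss series with c = a + b = 1 *)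

Section GaussSeries.
Context {R : realType} {a b : R}.
Hypotheses (a_ge0 : 0 <= a) (b_ge0 : 0 <= b) (ab1 : a + b = 1).

Definition gauss_coef k : R :=
  pochhammer a k * pochhammer b k / (pochhammer 1 k * k`!%:R).

Lemma gauss_coefS k :
  k.+1%:R ^+ 2 * gauss_coef k.+1 = (k%:R * k.+1%:R + a * b) * gauss_coef k.
Proof.
rewrite /gauss_coef /pochhammer !big_ord_recr/= factS natrM.
set p := \prod_(i < k) (a + _); set q := \prod_(i < k) (b + _).
set r := \prod_(i < k) (1 + _).
have r0 : r != 0.
  by apply/prodf_neq0 => i _; rewrite nat1r pnatr_eq0.
have f0 : k`!%:R != 0 :> R by rewrite pnatr_eq0 -lt0n fact_gt0.
have k0 : k.+1%:R != 0 :> R by rewrite pnatr_eq0.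
have -> : b = 1 - a by rewrite -ab1 addrC addKr.
have kE : k%:R = k.+1%:R - 1 :> R by rewrite -natr1 addrK.
rewrite kE; field.
by rewrite f0 r0 nat1r k0.
Qed.

Lemma gauss_coef0 : gauss_coef 0 = 1.
Proof. by rewrite /gauss_coef /pochhammer !big_ord0 fact0 !mul1r invr1. Qed.

(** The factor [(k (k + 1) + a b) / (k + 1)^2] of the recurrence is at most 1 because
    [a b <= 1 <= k + 1]. *)
Lemma gauss_coef_itv k : 0 <= gauss_coef k <= 1.
Proof.
elim: k => [|k /andP[c0 c1]]; first by rewrite gauss_coef0 ler01 lexx.
have k0 : 0 < k.+1%:R ^+ 2 :> R by rewrite exprn_gt0// ltr0n.
have ab0 : 0 <= a * b by exact: mulr_ge0.
have kge0 : 0 <= k%:R :> R by rewrite ler0n.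
have kk : 0 <= k%:R * k.+1%:R :> R by rewrite mulr_ge0 ?ler0n.
apply/andP; split.
  by rewrite -(pmulr_rge0 _ k0) gauss_coefS// mulr_ge0// addr_ge0.
rewrite -(ler_pM2l k0) gauss_coefS// mulr1.
have ab_le : a * b <= 1 by rewrite mulr_ile1// -ab1 ?lerDl ?lerDr.
apply: (@le_trans _ _ (k%:R * k.+1%:R + a * b)).
  by rewrite ler_piMr ?addr_ge0.
rewrite -natr1; nra.
Qed.

End GaussSeries.
Arguments gauss_coef {R} a b k.

(** [(k + 1) q^k] is at most the partial sum [1 + q + ... + q^k]. *)
Lemma natrM_expr_le {R : realType} (q : R) k : 0 <= q < 1 ->
  k.+1%:R * q ^+ k <= (1 - q)^-1.
Proof.
move=> /andP[q0 q1]; have q'0 : 0 < 1 - q by rewrite subr_gt0.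
rewrite -(ler_pM2r q'0) mulVf ?gt_eqF//.
have le_sum : \sum_(i < k.+1) q ^+ k <= \sum_(i < k.+1) q ^+ i.
  by apply: ler_sum => i _; rewrite ler_wiXn2l// ?ltW// -ltnS.
rewrite sumr_const card_ord -[leLHS]mulr_natl in le_sum.
apply: le_trans (ler_wpM2r (ltW q'0) le_sum) _.
rewrite mulrC -[1 - q]opprB mulNr -subrX1 opprB.
by rewrite gerBl exprn_ge0.
Qed.

(** Two differentiations multiply the coefficients by [(k + 1) (k + 2)]. Choosing [q < 1] with
    [|K| <= q^3], one factor [q^k] absorbs [k + 1], another absorbs [k + 2] up to a constant, and
    the third gives a convergent geometric series. *)
Lemma is_cvg_pseries_snd_diffs {R : realType} (c : nat -> R) K :
  (forall k, `|c k| <= 1) -> `|K| < 1 ->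
  [/\ cvgn (pseries c K), cvgn (pseries (pseries_diffs c) K)
    & cvgn (pseries (pseries_diffs (pseries_diffs c)) K)].
Proof.
move=> c1 K1.
have dom (u : nat -> R) M (q : R) : `|K| <= q ^+ 3 -> 0 <= q < 1 ->
   (forall k, `|u k| * q ^+ k ^+ 2 <= M) -> cvgn (pseries u K).
  move=> Kq /andP[q0 q1] uM.
  apply: normed_cvg; apply: (@series_le_cvg _ _ (geometric M q)).
  - by move=> n; rewrite normr_ge0.
  - move=> n; rewrite /= mulr_ge0// ?exprn_ge0//.
    by apply: le_trans (uM 0); rewrite mulr_ge0// exprn_ge0// exprn_ge0.
  - move=> n; rewrite /= normrM normrX.
    apply: (@le_trans _ _ (`|u n| * q ^+ 3 ^+ n)).
      by rewrite ler_wpM2l// lerXn2r// qualifE/= ?exprn_ge0.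
    have -> : q ^+ 3 ^+ n = q ^+ n ^+ 2 * q ^+ n.
      by rewrite -exprSr -!exprM mulnC.
    by rewrite mulrA ler_wpM2r// exprn_ge0.
  - by apply: is_cvg_geometric_series; rewrite ger0_norm.
have [q [Kq q01]] : exists q : R, `|K| <= q ^+ 3 /\ 0 <= q < 1.
  exists (1 - (1 - `|K|) / 3); have := normr_ge0 K.
  move: K1; set x := `|K| => x1 x0; split; last lra.
  (* the arithmetic mean of 1, 1 and x is at least their geometric mean *)
  have : 0 <= (x - 1) ^+ 2 * (x + 8) by rewrite mulr_ge0 ?sqr_ge0 ?addr_ge0.
  by nra.
have [q0 q1] := andP q01.
set M := (1 - q)^-1.
have M1 : 1 <= M by rewrite /M invf_ge1 ?subr_gt0// gerBl.
have bern k : k.+1%:R * q ^+ k <= M by exact: natrM_expr_le.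
have qk1 k : 0 <= q ^+ k <= 1 by rewrite exprn_ge0// exprn_ile1// ltW.
split; apply: (dom _ (2 * M ^+ 2) q) => // k.
- have := c1 k; have := normr_ge0 (c k); have := qk1 k.
  set x := q ^+ k; set y := `|c k| => /andP[x0 x1] y0 y1.
  apply: (@le_trans _ _ 1); last by nra.
  by rewrite mulr_ile1// ?exprn_ge0// exprn_ile1.
- rewrite /pseries_diffs normrM normr_nat.
  have := c1 k.+1; have := normr_ge0 (c k.+1); have := qk1 k; have := bern k.
  set x := q ^+ k; set y := `|c _|; set n := k.+1%:R => B /andP[x0 x1] y0 y1.
  have n0 : 0 <= n by rewrite ler0n.
  rewrite (_ : _ * _ = y * x * (n * x)); last by ring.
  apply: (@le_trans _ _ (1 * M)); last by nra.
  by rewrite ler_pM// ?mulr_ge0// mulr_ile1.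
- rewrite /pseries_diffs !normrM !normr_nat.
  have := c1 k.+2; have := normr_ge0 (c k.+2); have := qk1 k; have := bern k.
  have -> : k.+2%:R = k.+1%:R + 1 :> R by rewrite natr1.
  set x := q ^+ k; set y := `|c _|; set n := k.+1%:R => B /andP[x0 x1] y0 y1.
  have n1 : 1 <= n by rewrite ler1n.
  have n0 : 0 <= n by rewrite ler0n.
  rewrite (_ : _ * _ = y * ((n * x) * ((n + 1) * x))); last by ring.
  apply: (@le_trans _ _ (1 * (M * (2 * M)))); last by rewrite le_eqVlt; apply/orP; left; apply/eqP; ring.
  have nx0 : 0 <= n * x by rewrite mulr_ge0.
  rewrite ler_pM// ?mulr_ge0// ?addr_ge0//.
  rewrite ler_pM// ?mulr_ge0// ?addr_ge0//.
  by nra.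
Qed.

Section GaussFunction.
Context {R : realType} {a b : R}.
Hypotheses (a_ge0 : 0 <= a) (b_ge0 : 0 <= b) (ab1 : a + b = 1).

Local Notation F := (hypergeometric2F1 a b 1).
Local Notation c := (gauss_coef a b).

Let norm_coef k : `|c k| <= 1.
Proof. by have /andP[c0 c1] := gauss_coef_itv a_ge0 b_ge0 ab1 k; rewrite ger0_norm. Qed.

Lemma hypergeometric2F1_gt0 z : 0 <= z < 1 -> 0 < F z.
Proof.
move=> /andP[z0 z1]; apply: (@lt_le_trans _ _ 1) => //.
have [cvF _ _] : [/\ cvgn (pseries c z), cvgn (pseries (pseries_diffs c) z)
    & cvgn (pseries (pseries_diffs (pseries_diffs c)) z)].
  by apply: is_cvg_pseries_snd_diffs; rewrite ?ger0_norm.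
rewrite -[F z]/(limn (pseries c z)).
have ge1 n : 1 <= pseries c z n.+1.
  rewrite /pseries /series/= big_nat_recl//= gauss_coef0 mulr1 lerDl.
  apply: sumr_ge0 => i _; rewrite mulr_ge0// ?exprn_ge0//.
  by have /andP[] := gauss_coef_itv a_ge0 b_ge0 ab1 i.+1.
apply: limr_ge => //; near=> n.
by rewrite -(@prednK n) ?ge1//; near: n; exists 1.
Unshelve. all: by end_near. Qed.

Lemma hypergeometric2F1_at0 : F 0 = 1.
Proof.
rewrite -[F 0]/(limn (pseries c 0)).
have eq1 n : pseries c 0 n.+1 = 1.
  rewrite /pseries /series/= big_nat_recl//= gauss_coef0 mulr1.
  by rewrite big1 ?addr0// => i _; rewrite exprS mul0r mulr0.
apply/cvg_lim => //; apply: cvg_near_cst; near=> n.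
by rewrite -(@prednK n) ?eq1//; near: n; exists 1.
Unshelve. all: by end_near. Qed.

(** Self-adjoint form of the hypergeometric equation: when [a + b = 1], multiplying the coefficient of
    [z^(k+1)] in [z (1 - z) F'(z)] by [k + 1] gives [a b] times the coefficient of [z^k] in [F]. *)
Lemma gauss_equation : exists dF : R -> R, forall z : R, `|z| < 1 ->
  is_derive z 1 F (dF z) /\
  is_derive z 1 (fun z => z * (1 - z) * dF z) (a * b * F z).
Proof.
pose dF (z : R) : R := limn (pseries (pseries_diffs c) z).
exists dF => z z1.
pose K := (1 + `|z|) / 2.
have [zK K1] : `|z| < `|K| /\ `|K| < 1.
  by move: z1 (normr_ge0 z); rewrite /K; set x := `|z| => x1 x0; rewrite !ger0_norm; lra.
have cv u (u1 : `|u| < 1) := is_cvg_pseries_snd_diffs norm_coef u1.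
have [F0 F1 F2] := cv _ K1.
split; first exact: (pseries_snd_diffs F0 F1 F2 zK).
pose e k : R := if k is k'.+1 then a * b * c k' / k'.+1%:R else 0.
have eS k : pseries_diffs e k = a * b * c k.
  by rewrite /pseries_diffs /= mulrC divfK// pnatr_eq0.
have ab0 : 0 <= a * b by exact: mulr_ge0.
have ab_le1 : a * b <= 1.
  by rewrite mulr_ile1// -ab1 ?lerDl ?lerDr.
have e1 k : `|e k| <= 1.
  case: k => [|k]; first by rewrite normr0.
  have /andP[c0 c1] := gauss_coef_itv a_ge0 b_ge0 ab1 k.
  rewrite /= ger0_norm; last by rewrite divr_ge0// mulr_ge0.
  rewrite ler_pdivrMr ?ltr0n// mul1r (@le_trans _ _ 1) ?ler1n//.
  by rewrite mulr_ile1.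
have [E0 E1 E2] := is_cvg_pseries_snd_diffs e1 K1.
have -> : a * b * F z = limn (pseries (pseries_diffs e) z).
  have -> : pseries_diffs e = (fun k => a * b * c k) by apply/funext.
  rewrite -[F z]/(limn (pseries c z)).
  have [Fz _ _] := cv _ z1.
  apply/esym/cvg_lim => //.
  have -> : pseries (fun k => a * b * c k) z = (fun n => a * b * pseries c z n).
    apply/funext => n; rewrite /pseries /series/= mulr_sumr.
    by apply: eq_bigr => i _; rewrite mulrA.
  exact: cvgMl_tmp.
(* the coefficient of z^(k+1) in z (1 - z) F' is (k + 1) c_(k+1) - k c_k,
   and k + 1 times it is a b c_k by the recurrence *)
have partial (u : R) n : pseries e u n.+2 =
    u * pseries (pseries_diffs c) u n.+1 - u ^+ 2 * pseries (pseries_diffs c) u n.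
  elim: n => [|n IH].
    rewrite /pseries /series/= !big_nat_recr//= !big_nil /pseries_diffs/=.
    have c1E : c 1 = a * b.
      have := gauss_coefS ab1 0.
      by rewrite gauss_coef0 expr1n !mul1r mul0r add0r mulr1.
    by rewrite c1E gauss_coef0; field.
  have SE (v : nat -> R) m : pseries v u m.+1 = pseries v u m + v m * u ^+ m.
    by rewrite /pseries /series/= big_nat_recr.
  rewrite SE IH !SE /pseries_diffs/=.
  have n2 : n.+2%:R != 0 :> R by rewrite pnatr_eq0.
  have -> : a * b * c n.+1 = n.+2%:R ^+ 2 * c n.+2 - n.+1%:R * n.+2%:R * c n.+1.
    by rewrite gauss_coefS// mulrDl addrAC subrr add0r.
  rewrite !exprS.
  have -> : n.+2%:R = n.+1%:R + 1 :> R by rewrite natr1.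
  move: n2; rewrite -[n.+2%:R]natr1 => n2.
  field.
  by rewrite -natr1 in n2.
have lim_e u : `|u| < 1 -> limn (pseries e u) = u * (1 - u) * dF u.
  move=> u1; have [_ D1 _] := cv _ u1; have [e0 _ _] := is_cvg_pseries_snd_diffs e1 u1.
  have le : pseries e u n.+2 @[n --> \oo] --> limn (pseries e u).
    have := e0; rewrite -(cvg_shiftn 2).
    by under eq_fun do rewrite addn2.
  have re : (u * pseries (pseries_diffs c) u n.+1 -
             u ^+ 2 * pseries (pseries_diffs c) u n) @[n --> \oo] -->
           u * dF u - u ^+ 2 * dF u.
    apply: cvgB; apply: cvgMl_tmp.
      by rewrite (cvg_shiftS (pseries (pseries_diffs c) u)).
    exact: D1.
  rewrite (_ : u * (1 - u) * dF u = u * dF u - u ^+ 2 * dF u); last by ring.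
  have pE : (fun n => pseries e u n.+2) = _ := funext (partial u).
  by move: le; rewrite pE => le; exact: cvg_unique le re.
apply: (@near_eq_is_derive _ _ _ (fun u => limn (pseries e u))).
  near=> u; rewrite lim_e//; near: u.
  by apply: cvgr_lt z1; exact: cvg_norm.
exact: (pseries_snd_diffs E0 E1 E2 zK).
Unshelve. all: by end_near. Qed.

End GaussFunction.

(** * Derivatives of real functions *)

Section DerivativeRules.
Context {R : realType}.
Implicit Types (f g : R -> R) (x a b c : R).

Lemma is_derive_val f x a b : is_derive x 1 f a -> a = b -> is_derive x 1 f b.
Proof. by move=> fa <-. Qed.

Lemma is_derive_add f g x a b : is_derive x 1 f a -> is_derive x 1 g b ->
  is_derive x 1 (fun t => f t + g t) (a + b).
Proof. exact: is_deriveD. Qed.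

Lemma is_derive_opp f x a : is_derive x 1 f a ->
  is_derive x 1 (fun t => - f t) (- a).
Proof. exact: is_deriveN. Qed.

Lemma is_derive_mul f g x a b : is_derive x 1 f a -> is_derive x 1 g b ->
  is_derive x 1 (fun t => f t * g t) (a * g x + f x * b).
Proof.
move=> fa gb; apply: is_derive_eq.
by rewrite addrC; congr (_ + _); rewrite mulrC.
Qed.

Lemma is_derive_expr f n x a : is_derive x 1 f a ->
  is_derive x 1 (fun t => f t ^+ n) (n%:R * f x ^+ n.-1 * a).
Proof. by move=> fa; have := is_deriveX n fa; rewrite exprfctE. Qed.

Lemma is_derive_inv f x a : f x != 0 -> is_derive x 1 f a ->
  is_derive x 1 (fun t => (f t)^-1) (- f x ^- 2 * a).
Proof. by move=> f0 fa; exact: is_deriveV. Qed.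

Lemma is_derive_comp f g x a b : is_derive (g x) 1 f a -> is_derive x 1 g b ->
  is_derive x 1 (fun t => f (g t)) (a * b).
Proof. exact: is_derive1_comp. Qed.

Lemma is_derive_continuous f x a : is_derive x 1 f a -> {for x, continuous f}.
Proof.
by case=> fx _; apply/differentiable_continuous/derivable1_diffP.
Qed.

Lemma is_derive_within f (a b : R) (df : R -> R) :
  (forall x, a <= x <= b -> is_derive x 1 f (df x)) ->
  {within `[a, b], continuous f}.
Proof.
move=> fd; apply: derivable_within_continuous => x; rewrite in_itv/= => xab.
by case: (fd x xab).
Qed.

Lemma is_derive_sqrt f x a : 0 < f x -> is_derive x 1 f a ->
  is_derive x 1 (fun t => Num.sqrt (f t)) ((2 * Num.sqrt (f x))^-1 * a).
Proof. by move=> f0; apply: is_derive_comp; exact: is_derive1_sqrt. Qed.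

Lemma is_derive_rsqrt f x a : 0 < f x -> is_derive x 1 f a ->
  is_derive x 1 (fun t => (Num.sqrt (f t))^-1)
    (- (a / 2) * (Num.sqrt (f x))^-1 ^+ 3).
Proof.
move=> f0 fa; have s0 : Num.sqrt (f x) != 0 by rewrite gt_eqF// sqrtr_gt0.
have -> : - (a / 2) * (Num.sqrt (f x))^-1 ^+ 3 =
    - Num.sqrt (f x) ^- 2 * ((2 * Num.sqrt (f x))^-1 * a) by field.
exact: (@is_derive_inv (fun t => Num.sqrt (f t)) x _ s0 (is_derive_sqrt f0 fa)).
Qed.

End DerivativeRules.

(** The value of the derivative is an existential variable that the rules instantiate; conditions on
    denominators and radicands, and the functions that no rule matches, are left as goals. *)
Ltac derive_rec :=
  lazymatch goal with
  | |- is_derive _ _ (fun _ => ?c) _ => exact: is_derive_cst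
  | |- is_derive _ _ (fun _ => _ + _) _ => notypeclasses refine (is_derive_add _ _); derive_rec
  | |- is_derive _ _ (fun _ => - _) _ => notypeclasses refine (is_derive_opp _); derive_rec
  | |- is_derive _ _ (fun _ => _ * _) _ => notypeclasses refine (is_derive_mul _ _); derive_rec
  | |- is_derive _ _ (fun _ => _ ^+ _) _ => notypeclasses refine (is_derive_expr _ _); derive_rec
  | |- is_derive _ _ (fun _ => _ ^-1) _ =>
      first [ notypeclasses refine (is_derive_rsqrt _ _) | notypeclasses refine (is_derive_inv _ _) ]; derive_rec
  | |- is_derive _ _ (fun _ => Num.sqrt _) _ =>
      notypeclasses refine (is_derive_sqrt _ _); derive_rec
  (* unification eta-reduces a subterm such as fun t => c * t *)
  | |- is_derive ?x _ (GRing.mul ?c) _ =>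
      notypeclasses refine (@is_derive_mul _ (fun=> c) (fun t => t) x _ _ _ _); derive_rec
  | |- is_derive ?x _ (GRing.add ?c) _ =>
      notypeclasses refine (@is_derive_add _ (fun=> c) (fun t => t) x _ _ _ _); derive_rec
  | |- is_derive ?x _ (@GRing.opp _) _ =>
      notypeclasses refine (@is_derive_opp _ (fun t => t) x _ _); derive_rec
  | |- is_derive _ _ cos _ => exact: is_derive_cos
  | |- is_derive _ _ sin _ => exact: is_derive_sin
  | |- is_derive _ _ (fun x => x) _ => exact: is_derive_id
  | |- is_derive _ _ (fun x => cos x) _ => exact: is_derive_cos
  | |- is_derive _ _ (fun x => sin x) _ => exact: is_derive_sin
  | |- is_derive _ _ (fun _ => cos _) _ =>
      notypeclasses refine (is_derive_comp _ _); [exact: is_derive_cos|derive_rec]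
  | _ => idtac
  end.
Ltac derive := notypeclasses refine (is_derive_val _ _); [derive_rec|rewrite /=].

Lemma derive0_const {R : realType} (f : R -> R) (a b : R) : a < b ->
  (forall x, a < x < b -> is_derive x 1 f 0) ->
  {within `[a, b], continuous f} -> f a = f b.
Proof.
move=> ab f0 cf.
have fd x : x \in `]a, b[ -> is_derive x 1 f (cst 0 x).
  by rewrite in_itv/=; exact: f0.
have [c _] := MVT ab fd cf.
by rewrite mul0r => /eqP; rewrite subr_eq0 => /eqP ->.
Qed.

Section IntegralsOverSegments.
Context {R : realType}.
Notation mu := (@lebesgue_measure R).

Lemma Rintegral_FTC (F f : R -> R) (a b : R) : a < b ->
  (forall x, a <= x <= b -> is_derive x 1 F (f x)) ->
  {within `[a, b], continuous f} ->
  \int[mu]_(x in `[a, b]) f x = F b - F a.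
Proof.
move=> ab Ff cf.
have cF x : a <= x <= b -> {for x, continuous F}.
  by move=> xab; have := Ff _ xab; exact: is_derive_continuous.
rewrite /Rintegral (@continuous_FTC2 _ f F a b)//.
- split.
  + move=> x; rewrite in_itv/= => /andP[ax xb].
    by have [] := Ff x; rewrite // (ltW ax) (ltW xb).
  + by apply: cvg_at_right_filter; apply: cF; rewrite lexx ltW.
  + by apply: cvg_at_left_filter; apply: cF; rewrite lexx ltW.
- move=> x; rewrite in_itv/= => /andP[ax xb].
  by rewrite derive1E; have [] := Ff x; rewrite // (ltW ax) (ltW xb).
Qed.

Lemma continuous_segment_integrable (f : R -> R) (a b : R) :
  {within `[a, b], continuous f} -> mu.-integrable `[a, b] (EFin \o f).
Proof. by apply: continuous_compact_integrable; exact: segment_compact. Qed.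

(** Dominated convergence with the constant [M] as dominating function. *)
Lemma is_derive_Rintegral (f df : R -> R -> R) (x u v a b M : R) : u < x < v ->
  (forall t s, u < t < v -> a <= s <= b -> is_derive t 1 (f ^~ s) (df t s)) ->
  (forall t, u < t < v -> {within `[a, b], continuous (f t)}) ->
  (forall t s, u < t < v -> a <= s <= b -> `|df t s| <= M) ->
  is_derive x 1 (fun t => \int[mu]_(s in `[a, b]) f t s)
    (\int[mu]_(s in `[a, b]) df x s).
Proof.
move=> xuv fdf cf dfM.
have dE (t s : R) : u < t < v -> a <= s <= b -> partial1of2 f t s = df t s.
  move=> tuv sab; rewrite partial1of2E.
  by have [] := fdf _ _ tuv sab.
have xI : (`]u, v[%classic : set R) x by rewrite /= in_itv.
have ICE t : (`]u, v[%classic : set R) t -> u < t < v by rewrite /= in_itv.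
have JE s : (`[a, b]%classic : set R) s -> a <= s <= b by rewrite /= in_itv.
have intf t : (`]u, v[%classic : set R) t -> mu.-integrable `[a, b] (EFin \o f t).
  by move=> /ICE tuv; apply: continuous_segment_integrable; exact: cf.
have derf t s : (`]u, v[%classic : set R) t -> (`[a, b]%classic : set R) s ->
    derivable (f ^~ s) t 1.
  by move=> /ICE tuv /JE sab; have [] := fdf _ _ tuv sab.
have bndf t s : (`]u, v[%classic : set R) t -> (`[a, b]%classic : set R) s ->
    `|partial1of2 f t s| <= cst `|M| s.
  by move=> /ICE tuv /JE sab; rewrite dE//= (le_trans (dfM _ _ tuv sab))// ler_norm.
have cst0 (s : R) : 0 <= cst `|M| s :> R by rewrite /= normr_ge0.
have intM : mu.-integrable `[a, b] (EFin \o cst `|M|).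
  apply: continuous_segment_integrable.
  by apply: continuous_subspaceT => s; exact: cvg_cst.
have drv := fun mB => derivable_under_integral mB xI intf derf cst0 intM bndf.
have dvl := fun mB => differentiation_under_integral mB xI intf derf cst0 intM bndf.
apply: DeriveDef; first by apply: drv; exact: measurable_itv.
rewrite -derive1E dvl; last exact: measurable_itv.
apply: eq_Rintegral => s.
by rewrite inE/= in_itv/= => sab; rewrite dE.
Qed.

End IntegralsOverSegments.

(** * The elliptic integral *)

Section EllipticIntegral.
Context {R : realType}.
Notation mu := (@lebesgue_measure R).
Implicit Types (x c s t : R).

(** With [r^2 = 1 + x^2 + 2 x c], the squared length of the difference of two vectors of lengths [x]
    and 1 whose angle has cosine [- c], this is [r^2 (4 - r^2)]. The planar density after two steps is
    [1 / (pi^2 r sqrt (4 - r^2))]. *)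
Definition walk_quartic x c : R :=
  (1 + x ^+ 2 + 2 * x * c) * (3 - x ^+ 2 - 2 * x * c).

Definition walk_kernel x c : R := (Num.sqrt (walk_quartic x c))^-1.

Definition walk_integral x : R :=
  \int[mu]_(s in `[0, pi]) walk_kernel x (cos s).

(** Each of the two factors is at least [(1 - |x|)^2]. *)
Lemma walk_quartic_ge x c : `|x| <= 1 -> -1 <= c <= 1 ->
  (1 - `|x|) ^+ 4 <= walk_quartic x c.
Proof.
move=> x1 /andP[c1 c2]; rewrite /walk_quartic.
have h (y d : R) : 0 <= y -> y <= 1 -> -1 <= d <= 1 ->
  (1 - y) ^+ 4 <= (1 + y ^+ 2 + 2 * y * d) * (3 - y ^+ 2 - 2 * y * d).
  move=> y0 y1 /andP[d1 d2].
  have -> : (1 - y) ^+ 4 = (1 - y) ^+ 2 * (1 - y) ^+ 2 by ring.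
  apply: ler_pM; rewrite ?sqr_ge0//; nra.
have [x0|x0] := lerP 0 x.
  by rewrite ger0_norm// in x1 *; apply: h; rewrite ?c1.
rewrite ltr0_norm// in x1 *.
have -> : 1 + x ^+ 2 + 2 * x * c = 1 + (- x) ^+ 2 + 2 * (- x) * (- c) by ring.
have -> : 3 - x ^+ 2 - 2 * x * c = 3 - (- x) ^+ 2 - 2 * (- x) * (- c) by ring.
by apply: h => //; [rewrite oppr_ge0 ltW|rewrite lerNl opprK c2 lerNl c1].
Qed.

Lemma walk_quartic_gt0 x c : `|x| < 1 -> -1 <= c <= 1 -> 0 < walk_quartic x c.
Proof.
move=> x1 c1; apply: lt_le_trans (walk_quartic_ge (ltW x1) c1).
by rewrite exprn_gt0// subr_gt0.
Qed.

Let Qx x c : R := (1 - x ^+ 2 - 2 * x * c) * (4 * (x + c)).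
Let kx x c : R := - (Qx x c / 2) * walk_kernel x c ^+ 3.
Let kxx x c : R :=
  3 / 4 * Qx x c ^+ 2 * walk_kernel x c ^+ 5
  - (2 * (1 - x ^+ 2 - 2 * x * c) - 4 * (x + c) ^+ 2) * walk_kernel x c ^+ 3.

Lemma is_derive_walk_kernel x c : `|x| < 1 -> -1 <= c <= 1 ->
  is_derive x 1 (walk_kernel ^~ c) (kx x c).
Proof.
move=> x1 c1; have Q0 := walk_quartic_gt0 x1 c1.
rewrite /walk_kernel/= /kx /walk_kernel.
notypeclasses refine (is_derive_val (is_derive_rsqrt _ _) _).
- exact: Q0.
- rewrite /walk_quartic; derive_rec.
- by rewrite /Qx /=; set w := (Num.sqrt _)^-1; field.
Qed.

Lemma is_derive2_walk_kernel x c : `|x| < 1 -> -1 <= c <= 1 ->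
  is_derive x 1 (kx ^~ c) (kxx x c).
Proof.
move=> x1 c1; rewrite /kx /Qx/=; derive; first exact: is_derive_walk_kernel.
by rewrite /kxx /kx /Qx/=; set w := walk_kernel x c; field.
Qed.

Let p x : R := x * (9 - x ^+ 2) * (1 - x ^+ 2).
Let N x c : R := (- 18 + 54 * x ^+ 2 - 6 * x ^+ 4 + 2 * x ^+ 6)
  + (36 * x - 8 * x ^+ 3 + 4 * x ^+ 5) * c.

(** Creative telescoping: the operator that annihilates the integral maps the integrand to a total
    derivative in [s]. The polynomial [N] comes from the ansatz [sin s * N(x, cos s) * kernel^3] with
    [N] of degree 1 in [cos s], by comparing the coefficients of the powers of [cos s]. *)
Lemma walk_kernel_certificate x s : `|x| < 1 ->
  is_derive s 1 (fun s => sin s * N x (cos s) * walk_kernel x (cos s) ^+ 3)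
    ((9 - 30 * x ^+ 2 + 5 * x ^+ 4) * kx x (cos s) + p x * kxx x (cos s)
     - 4 * x * (3 - x ^+ 2) * walk_kernel x (cos s)).
Proof.
move=> x1; have c1 : -1 <= cos s <= 1 by rewrite cos_geN1 cos_le1.
have Q0 := walk_quartic_gt0 x1 c1.
rewrite /N /walk_kernel/=; derive.
- exact: Q0.
- rewrite /walk_quartic; derive_rec.
have wE : (Num.sqrt (walk_quartic x (cos s)))^-1 ^+ 2 * walk_quartic x (cos s) = 1.
  by rewrite exprVn sqr_sqrtr ?ltW// mulVf// gt_eqF.
rewrite /kxx /kx /Qx /p /walk_kernel/=.
move: wE; set w := (Num.sqrt _)^-1; rewrite /walk_quartic.
have := cos2Dsin2 s.
set c := cos s; set z := sin s => cz wE.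
have z2 : z ^+ 2 = 1 - c ^+ 2 by rewrite -cz addrC addKr.
(* as w^2 Q = 1, every odd power of w is w^5 times a power of Q *)
pose Q := (1 + x ^+ 2 + 2 * x * c) * (3 - x ^+ 2 - 2 * x * c).
have w3 : w ^+ 3 = w ^+ 5 * Q.
  by rewrite -[LHS]mulr1 -wE /Q; ring.
have w1 : w = w ^+ 5 * Q ^+ 2.
  by rewrite -[LHS]mulr1 -[X in _ * X](mulr1 1) -wE /Q; ring.
pose n := (- 18 + 54 * x ^+ 2 - 6 * x ^+ 4 + 2 * x ^+ 6)
  + (36 * x - 8 * x ^+ 3 + 4 * x ^+ 5) * c.
transitivity ((c * n - z ^+ 2 * (36 * x - 8 * x ^+ 3 + 4 * x ^+ 5)) * w ^+ 3
  + 3 * x * z ^+ 2 * n * (2 - 2 * x ^+ 2 - 4 * x * c) * w ^+ 5).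
  by rewrite /n/=; field.
rewrite z2 w3 /n.
have -> : 4 * x * (3 - x ^+ 2) * w = 4 * x * (3 - x ^+ 2) * (w ^+ 5 * Q ^+ 2).
  by rewrite -w1.
by rewrite /Q; field.
Qed.

Let walk_kernel_cos t s : `|t| < 1 -> exists a, is_derive s 1 (fun s => walk_kernel t (cos s)) a.
Proof.
move=> t1; eexists; rewrite /walk_kernel; derive_rec.
  by apply: walk_quartic_gt0 => //; rewrite cos_geN1 cos_le1.
by rewrite /walk_quartic; derive_rec.
Qed.

Lemma continuous_walk_kernel t (A : set R) : `|t| < 1 ->
  {within A, continuous (fun s => walk_kernel t (cos s))}.
Proof.
move=> t1; apply: continuous_subspaceT => s.
by have [a /is_derive_continuous] := walk_kernel_cos s t1.
Qed.

Let cvg_kx t (A : set R) : `|t| < 1 -> {within A, continuous (fun s => kx t (cos s))}.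
Proof.
move=> t1; apply: continuous_subspaceT => s.
have [a wa] := walk_kernel_cos s t1.
by notypeclasses refine (is_derive_continuous _); rewrite /kx /Qx/=; derive_rec; exact: wa.
Qed.

Let cvg_kxx t (A : set R) : `|t| < 1 -> {within A, continuous (fun s => kxx t (cos s))}.
Proof.
move=> t1; apply: continuous_subspaceT => s.
have [a wa] := walk_kernel_cos s t1.
by notypeclasses refine (is_derive_continuous _); rewrite /kxx /Qx/=; derive_rec; exact: wa.
Qed.

Let kernel_le (r t c : R) : `|t| < r -> r < 1 -> -1 <= c <= 1 ->
  0 <= walk_kernel t c <= (1 - r) ^- 2.
Proof.
move=> tr r1 c1; rewrite invr_ge0 sqrtr_ge0/=.
have r0 : 0 < 1 - r by rewrite subr_gt0.
have t1 : `|t| < 1 by exact: lt_trans r1.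
rewrite lef_pV2 ?qualifE/= ?exprn_gt0 ?sqrtr_gt0 ?walk_quartic_gt0//.
rewrite -(@ger0_norm _ ((1 - r) ^+ 2)) ?sqr_ge0// -sqrtr_sqr ler_wsqrtr//.
apply: le_trans (walk_quartic_ge (ltW t1) c1).
by rewrite -exprM lerXn2r ?qualifE/= ?(ltW r0)// ?subr_ge0 ?(ltW t1)// lerD2l lerN2 ltW.
Qed.

Let kx_le (r t c : R) : `|t| < r -> r < 1 -> -1 <= c <= 1 ->
  `|kx t c| <= 16 * (1 - r) ^- 2 ^+ 3.
Proof.
move=> tr r1 c1; have /andP[w0 wr] := kernel_le tr r1 c1.
have t1 : `|t| < 1 by exact: lt_trans r1.
rewrite /kx normrM ler_pM//.
  move: t1 c1; rewrite ltr_norml => /andP[t1 t2] /andP[c1 c2].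
  have h1 : `|1 - t ^+ 2 - 2 * t * c| <= 4 by rewrite ler_norml; apply/andP; split; nra.
  have h2 : `|4 * (t + c)| <= 8 by rewrite ler_norml; apply/andP; split; lra.
  rewrite normrN normrM [X in _ * X]ger0_norm// ler_pdivrMr// /Qx normrM.
  by rewrite (_ : 16 * 2 = 4 * 8); [rewrite ler_pM|ring].
by rewrite ger0_norm ?exprn_ge0// lerXn2r// qualifE/= (le_trans w0 wr).
Qed.

Let kxx_le (r t c : R) : `|t| < r -> r < 1 -> -1 <= c <= 1 ->
  `|kxx t c| <= 768 * (1 - r) ^- 2 ^+ 5 + 24 * (1 - r) ^- 2 ^+ 3.
Proof.
move=> tr r1 c1; have /andP[w0 wr] := kernel_le tr r1 c1.
have t1 : `|t| < 1 by exact: lt_trans r1.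
move: t1 c1; rewrite ltr_norml => /andP[t1 t2] /andP[c1 c2].
have h1 : `|1 - t ^+ 2 - 2 * t * c| <= 4 by rewrite ler_norml; apply/andP; split; nra.
have h2 : `|4 * (t + c)| <= 8 by rewrite ler_norml; apply/andP; split; lra.
have wX n : `|walk_kernel t c ^+ n| <= (1 - r) ^- 2 ^+ n.
  by rewrite ger0_norm ?exprn_ge0// lerXn2r// qualifE/= (le_trans w0 wr).
rewrite /kxx (le_trans (ler_normB _ _))// lerD//.
  rewrite normrM ler_pM// normrM normrX (_ : 768 = 3 / 4 * (4 * 8) ^+ 2); last by field.
  rewrite ger0_norm ?divr_ge0// ler_wpM2l// lerXn2r ?qualifE/= ?normr_ge0//.
  by rewrite /Qx normrM ler_pM.
rewrite normrM ler_pM// (le_trans (ler_normB _ _))//.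
rewrite (_ : 24 = 2 * 4 + 4 * 2 ^+ 2); last by ring.
rewrite lerD// normrM ?normrX ger0_norm// ler_wpM2l// lerXn2r ?qualifE/= ?normr_ge0//.
by rewrite ler_norml; apply/andP; split; lra.
Qed.

(** The total derivative of [walk_kernel_certificate] carries a factor [sin] and thus integrates to
    zero over a half period. *)
Lemma walk_integral_equation : exists dG : R -> R, forall x, `|x| < 1 ->
  is_derive x 1 walk_integral (dG x) /\
  is_derive x 1 (fun x => x * (9 - x ^+ 2) * (1 - x ^+ 2) * dG x)
    (4 * x * (3 - x ^+ 2) * walk_integral x).
Proof.
exists (fun x => \int[mu]_(s in `[0, pi]) kx x (cos s)) => x x1.
pose r := (1 + `|x|) / 2.
have xr : - r < x < r.
  by rewrite -ltr_norml /r; move: x1; set y := `|x| => y1; lra.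
have r1 : r < 1 by move: x1; rewrite /r; set y := `|x| => y1; lra.
have tr (t : R) : - r < t < r -> `|t| < r by rewrite -ltr_norml.
have t1 (t : R) : - r < t < r -> `|t| < 1 by move=> /tr h; exact: lt_trans r1.
have c1 (s : R) : -1 <= cos s <= 1 by rewrite cos_geN1 cos_le1.
have d1 : is_derive x 1 walk_integral (\int[mu]_(s in `[0, pi]) kx x (cos s)).
  apply: (@is_derive_Rintegral _ (fun t s => walk_kernel t (cos s))
    (fun t s => kx t (cos s)) x (- r) r 0 pi _ xr) => [t s /t1 ? _|t /t1 ?|t s /tr ? _].
  - exact: is_derive_walk_kernel.
  - exact: continuous_walk_kernel.
  - exact: (kx_le _ r1).
have d2 : is_derive x 1 (fun x => \int[mu]_(s in `[0, pi]) kx x (cos s))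
    (\int[mu]_(s in `[0, pi]) kxx x (cos s)).
  apply: (@is_derive_Rintegral _ (fun t s => kx t (cos s))
    (fun t s => kxx t (cos s)) x (- r) r 0 pi _ xr) => [t s /t1 ? _|t /t1 ?|t s /tr ? _].
  - exact: is_derive2_walk_kernel.
  - exact: cvg_kx.
  - exact: (kxx_le _ r1).
split=> //; derive; first exact: d2.
have iK (f : R -> R) : {within `[0, pi], continuous f} ->
   mu.-integrable `[0, pi] (EFin \o f) by exact: continuous_segment_integrable.
have i0 := iK _ (continuous_walk_kernel x1).
have i1 := iK _ (cvg_kx x1).
have i2 := iK _ (cvg_kxx x1).
have int0 := Rintegral_FTC (pi_gt0 R) (fun s _ => walk_kernel_certificate s x1).
rewrite sinpi sin0 !mul0r subrr in int0.
have mI : measurable (`[0, pi]%classic : set (measurableTypeR R)).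
  exact: measurable_itv.
have iZ k (f : R -> R) : mu.-integrable `[0, pi] (EFin \o f) ->
   mu.-integrable `[0, pi] (EFin \o (fun s => k * f s)).
  by move=> fi; exact: (integrableZl mI k fi).
rewrite RintegralB// in int0; last 2 first.
- exact: (integrableD mI (iZ _ _ i1) (iZ _ _ i2)).
- exact: iZ.
rewrite RintegralD// in int0; [|exact: iZ|exact: iZ].
rewrite !RintegralZl// in int0.
apply/eqP; rewrite -subr_eq0; apply/eqP; rewrite -[RHS]int0; last first.
  apply: continuous_subspaceT => s; have [a wa] := walk_kernel_cos s x1.
  notypeclasses refine (is_derive_continuous _); rewrite /kxx /kx /Qx/=.
  by derive_rec; exact: wa.
rewrite /walk_integral /p.
ring.
Qed.

End EllipticIntegral.

(** * Evaluation of the elliptic integral *)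

Section Evaluation.
Context {R : realType}.
Notation mu := (@lebesgue_measure R).
Implicit Types (x : R).

Definition walk_modulus x : R := x ^+ 2 * (9 - x ^+ 2) ^+ 2 / (3 + x ^+ 2) ^+ 3.

Local Notation F := (hypergeometric2F1 (1 / 3 : R) (2 / 3) 1).

Definition walk_gauss x : R := 3 / (3 + x ^+ 2) * F (walk_modulus x).

Let den_gt0 x : 0 < 3 + x ^+ 2.
Proof. by rewrite ltr_pwDl ?sqr_ge0. Qed.

Let den_neq0 x : 3 + x ^+ 2 != 0.
Proof. by rewrite gt_eqF. Qed.

Lemma walk_modulus_ge0 x : 0 <= walk_modulus x.
Proof.
rewrite /walk_modulus; apply: divr_ge0.
  by apply: mulr_ge0; exact: sqr_ge0.
by apply/exprn_ge0/ltW.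
Qed.

(** [1 - z = 27 (1 - x^2)^2 / (3 + x^2)^3]. *)
Lemma walk_modulus_lt1 x : x ^+ 2 != 1 -> walk_modulus x < 1.
Proof.
move=> x1; rewrite -subr_gt0.
have -> : 1 - walk_modulus x = 27 * (1 - x ^+ 2) ^+ 2 / (3 + x ^+ 2) ^+ 3.
  by rewrite /walk_modulus; field; exact: den_neq0.
rewrite divr_gt0 ?exprn_gt0// mulr_gt0// lt0r sqr_ge0 andbT.
by rewrite expf_eq0/= subr_eq0 eq_sym.
Qed.

Let modulus_norm x : `|x| < 1 -> `|walk_modulus x| < 1.
Proof.
move=> x1; rewrite ger0_norm ?walk_modulus_ge0// walk_modulus_lt1//.
by rewrite -real_normK ?num_real// lt_eqF// expr_lt1.
Qed.

Let dmodulus x : R :=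
  54 * x * (1 - x ^+ 2) * (9 - x ^+ 2) / (3 + x ^+ 2) ^+ 4.

Let is_derive_modulus x : is_derive x 1 walk_modulus (dmodulus x).
Proof.
rewrite /walk_modulus; derive; first by rewrite expf_neq0.
by rewrite /dmodulus; field.
Qed.

(** With [m = 3 / (3 + x^2)], [z] the modulus and [p = x (9 - x^2) (1 - x^2)], the function
    [p m^2 z' / (z (1 - z))] is the constant 18. Hence [p (m F(z))'] is
    [p m' F(z) + 18 / m * (z (1 - z) F'(z))], and Gauss' equation becomes the equation of
    [walk_integral_equation]. *)
Lemma walk_gauss_equation : exists dH : R -> R, forall x, `|x| < 1 ->
  is_derive x 1 walk_gauss (dH x) /\
  is_derive x 1 (fun x => x * (9 - x ^+ 2) * (1 - x ^+ 2) * dH x)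
    (4 * x * (3 - x ^+ 2) * walk_gauss x).
Proof.
have [dF FE] := @gauss_equation R (1 / 3) (2 / 3) ltac:(lra) ltac:(lra) ltac:(lra).
pose E z := z * (1 - z) * dF z.
exists (fun x => - (6 * x) / (3 + x ^+ 2) ^+ 2 * F (walk_modulus x)
   + 3 / (3 + x ^+ 2) * (dF (walk_modulus x) * dmodulus x)) => x x1.
have [F1 F2] := FE _ (modulus_norm x1).
split.
  rewrite /walk_gauss; derive; first exact: den_neq0.
    exact: (is_derive_comp F1 (is_derive_modulus x)).
  by field.
have -> : (fun x => x * (9 - x ^+ 2) * (1 - x ^+ 2) *
    (- (6 * x) / (3 + x ^+ 2) ^+ 2 * F (walk_modulus x)
      + 3 / (3 + x ^+ 2) * (dF (walk_modulus x) * dmodulus x))) =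
  (fun x => - (6 * x ^+ 2 * (9 - x ^+ 2) * (1 - x ^+ 2)) / (3 + x ^+ 2) ^+ 2 * F (walk_modulus x)
      + 6 * (3 + x ^+ 2) * E (walk_modulus x)).
  apply/funext => t; rewrite /E /dmodulus; set d := dF _; set f := F _.
  by rewrite /walk_modulus; field.
derive.
- by rewrite expf_neq0.
- exact: (is_derive_comp F1 (is_derive_modulus x)).
- exact: (is_derive_comp F2 (is_derive_modulus x)).
rewrite /walk_gauss /E /dmodulus; set d := dF _; set f := F _.
by rewrite /walk_modulus; field.
Qed.

(** Both sides solve the same second-order equation, and the Wronskian times
    [x (9 - x^2) (1 - x^2)] is constant; it vanishes at the singular point 0 of the equation, where
    both solutions are regular. *)
Lemma walk_integralE x : 0 <= x < 1 ->
  walk_integral x = pi / Num.sqrt 3 * walk_gauss x.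
Proof.
move=> /andP[x0 x1].
have [dG GE] := @walk_integral_equation R.
have [dH HE] := walk_gauss_equation.
pose p (t : R) := t * (9 - t ^+ 2) * (1 - t ^+ 2).
pose u t := p t * dG t.
pose v t := p t * dH t.
pose W t := walk_integral t * v t - u t * walk_gauss t.
have dW (t : R) : `|t| < 1 -> is_derive t 1 W 0.
  move=> t1; have [G1 G2] := GE _ t1; have [H1 H2] := HE _ t1.
  rewrite /W; derive; [exact: G1|exact: H2|exact: G2|exact: H1|].
  by rewrite /u /v /p; ring.
have W0 (t : R) : 0 <= t < 1 -> W t = 0.
  move=> /andP[t0 t1].
  have -> : 0 = W 0 by rewrite /W /u /v /p; ring.
  have [->//|tn0] := eqVneq t 0.
  apply/esym/derive0_const; first by rewrite lt_neqAle eq_sym tn0.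
    by move=> s /andP[s0 st]; apply: dW; rewrite gtr0_norm// (lt_trans st).
  apply: is_derive_within => s /andP[s0 st]; apply: dW.
  by rewrite ger0_norm// (le_lt_trans st).
have H0 (t : R) : 0 <= t < 1 -> walk_gauss t != 0.
  move=> /andP[t0 t1]; rewrite gt_eqF// mulr_gt0 ?divr_gt0//.
  apply: hypergeometric2F1_gt0; try lra.
  by rewrite walk_modulus_ge0 walk_modulus_lt1// lt_eqF// expr_lt1.
have dQ (t : R) : 0 <= t < 1 -> is_derive t 1 (fun t => walk_integral t / walk_gauss t)
    ((dG t * walk_gauss t - walk_integral t * dH t) / walk_gauss t ^+ 2).
  move=> t01; have t1 : `|t| < 1 by case/andP: t01 => ? ?; rewrite ger0_norm.
  have [G1 _] := GE _ t1; have [H1 _] := HE _ t1.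
  derive; [exact: G1|exact: H0|exact: H1|].
  by field; exact: H0.
have Q0 : walk_integral 0 / walk_gauss 0 = pi / Num.sqrt 3.
  have -> : walk_gauss 0 = 1.
    rewrite /walk_gauss /walk_modulus !expr0n/= !mul0r hypergeometric2F1_at0 addr0.
    by rewrite divff// mul1r.
  rewrite divr1 /walk_integral /walk_kernel /walk_quartic.
  rewrite (_ : (fun s => _) = fun=> (Num.sqrt 3)^-1); last first.
    apply/funext => s; congr (Num.sqrt _)^-1; ring.
  rewrite Rintegral_cst; last exact: measurable_itv.
  have mpi : lebesgue_measure (`[0, pi]%classic : set R) = pi%:E.
    by rewrite lebesgue_measure_itv/= lte_fin pi_gt0 oppr0 adde0.
  by rewrite (_ : fine _ = pi) 1?mulrC//; have := congr1 fine mpi.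
have [->|xn0] := eqVneq x 0; first by rewrite -Q0 mulfVK// H0// lexx ltr01.
have x01 : 0 <= x < 1 by rewrite x0.
suff QE : walk_integral 0 / walk_gauss 0 = walk_integral x / walk_gauss x.
  by rewrite -Q0 QE mulfVK ?H0.
apply: (@derive0_const _ (fun t => walk_integral t / walk_gauss t)).
- by rewrite lt_neqAle eq_sym xn0.
- move=> t /andP[t0 tx].
  have t01 : 0 <= t < 1 by rewrite ltW// (lt_trans tx).
  apply: is_derive_val; first exact: dQ.
  have /eqP := W0 _ t01; rewrite subr_eq0 => /eqP WE.
  have pt : p t != 0.
    have t1 := lt_trans tx x1.
    by rewrite gt_eqF// /p; apply: mulr_gt0; [apply: mulr_gt0 => //|]; nra.
  apply/eqP; rewrite mulf_eq0; apply/orP; left; rewrite subr_eq0.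
  apply/eqP/(mulfI pt); transitivity (u t * walk_gauss t); first by rewrite /u; ring.
  by rewrite -WE /v; ring.
- apply: is_derive_within => t /andP[t0 tx]; apply: dQ.
  by rewrite t0 (le_lt_trans tx).
Qed.

End Evaluation.

(** * Change of variable on an open interval *)

Section Substitution.
Context {R : realType}.
Notation mu := (@lebesgue_measure R).
Variables (F f G : R -> R) (a b : R).
Hypothesis ab : a < b.
Hypothesis Ff : forall x, a < x < b -> is_derive x 1 F (f x).
Hypothesis f_gt0 : forall x, a < x < b -> 0 < f x.
Hypothesis cf : forall x, a < x < b -> {for x, continuous f}.
Hypothesis cG : forall x, a < x < b -> {for F x, continuous G}.
Hypothesis G_ge0 : forall x, a < x < b -> 0 <= G (F x).

Let cF x : a < x < b -> {for x, continuous F}.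
Proof. by move=> xab; have := Ff xab; exact: is_derive_continuous. Qed.

Let sub_oo u v x : a < u -> v < b -> u <= x <= v -> a < x < b.
Proof.
by move=> au vb /andP[ux xv]; rewrite (lt_le_trans au ux) (le_lt_trans xv vb).
Qed.

Let cFuv u v : a < u -> v < b -> {within `[u, v], continuous F}.
Proof.
move=> au vb; apply: is_derive_within => x xuv.
exact/Ff/(sub_oo au vb).
Qed.

Let F_incr u v : a < u -> v < b -> u < v -> F u < F v.
Proof.
move=> au vb uv.
have Fd x : x \in `]u, v[ -> is_derive x 1 F (f x).
  rewrite in_itv/= => /andP[ux xv]; apply/Ff/(sub_oo au vb).
  by rewrite !ltW.
have [c + FE] := MVT uv Fd (cFuv au vb).
rewrite in_itv/= => /andP[uc cv].
rewrite -subr_gt0 FE mulr_gt0 ?subr_gt0// f_gt0//.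
by apply: (sub_oo au vb); rewrite !ltW.
Qed.

Let imageF u v : a < u -> v < b -> u < v -> F @` `[u, v] = `[F u, F v]%classic.
Proof.
move=> au vb uv.
have Fuv x y : u <= x -> x <= y -> y <= v -> F x <= F y.
  rewrite le_eqVlt => + + yv; rewrite le_eqVlt => ux /predU1P[->//|xy].
  apply/ltW/F_incr => //; last exact: le_lt_trans vb.
  by case/predU1P: ux => [<-//|]; exact: lt_trans.
apply/seteqP; split => [_ [x /= + <-]|y /=]; rewrite !in_itv/=.
  by move=> /andP[ux xv]; rewrite !Fuv.
move=> yF; have [|c cuv <-] := IVT (ltW uv) (cFuv au vb) (v := y).
  by rewrite minEle maxEle (Fuv _ _ (lexx u) (ltW uv) (lexx v)).
by exists c.
Qed.

Lemma substitution_segment u v : a < u -> v < b -> u < v ->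
  (\int[mu]_(t in F @` `[u, v]) (G t)%:E =
   \int[mu]_(x in `[u, v]) (G (F x) * f x)%:E)%E.
Proof.
move=> au vb uv; rewrite imageF//.
have uvE x : x \in `]u, v[ -> a < x < b.
  rewrite in_itv/= => /andP[ux xv]; apply: (sub_oo au vb).
  by rewrite !ltW.
have uab : a < u < b by rewrite au (lt_trans uv).
have vab : a < v < b by rewrite vb (lt_trans au).
have dFE x : a < x < b -> (F^`())%classic x = f x.
  by move=> xab; rewrite derive1E; have [] := Ff xab.
have nearE x : a < x < b -> {near x, (F^`())%classic =1 f}.
  move=> xab; near=> y; apply: dFE.
  by near: y; apply: near_in_itvoo; rewrite in_itv.
rewrite (@integration_by_substitution_increasing _ F G u v)//.
- apply: eq_integral => x; rewrite inE/= in_itv/= => xuv.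
  by rewrite !fctE dFE//; exact: (sub_oo au vb).
- exact: ltW.
- move=> x y; rewrite !in_itv/= => /andP[ux xv] /andP[uy yv] xy.
  by apply: F_incr => //; [exact: lt_le_trans ux|exact: le_lt_trans vb].
- move=> x /uvE xab; rewrite /continuous_at dFE//.
  apply: cvg_trans (cf xab); apply: near_eq_cvg.
  by have := nearE _ xab; apply: filterS => y ->.
- apply/cvg_ex; exists (f u); apply: cvg_at_right_filter.
  apply: cvg_trans (cf uab); apply: near_eq_cvg.
  by have := nearE _ uab; apply: filterS => y ->.
- apply/cvg_ex; exists (f v); apply: cvg_at_left_filter.
  apply: cvg_trans (cf vab); apply: near_eq_cvg.
  by have := nearE _ vab; apply: filterS => y ->.
- split.
  + by move=> x /uvE xab; have [] := Ff xab.
  + by apply: cvg_at_right_filter; exact: cF.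
  + by apply: cvg_at_left_filter; exact: cF.
- rewrite -imageF//; apply: continuous_in_subspaceT => y.
  rewrite inE/= => -[x] /=; rewrite in_itv/= => xuv <-.
  exact/cG/(sub_oo au vb).
Unshelve. all: by end_near. Qed.

Let d n : R := (b - a) / (n + 3)%N%:R.
Let I n : set R := `[a + d n, b - d n]%classic.

Let d_bnd n : [/\ a < a + d n, b - d n < b & a + d n < b - d n].
Proof.
have ba : 0 < b - a by rewrite subr_gt0.
have d0 : 0 < d n by rewrite divr_gt0// ltr0n addnS.
split; [by rewrite ltrDl|by rewrite gtrBl|].
rewrite -subr_gt0 (_ : _ - _ = (b - a) * (1 - 2 / (n + 3)%N%:R)); last by rewrite /d; ring.
rewrite mulr_gt0// subr_gt0 ltr_pdivrMr ?ltr0n ?addnS// mul1r ltr_nat.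
by rewrite !ltnS.
Qed.

Let d_decr m n : (m <= n)%N -> d n <= d m.
Proof.
move=> mn; rewrite /d ler_pM2l ?subr_gt0// lef_pV2 ?qualifE/= ?ltr0n ?addnS//.
by rewrite ler_nat !ltnS leq_add2r.
Qed.

Let I_nd : nondecreasing_seq I.
Proof.
move=> m n mn; rewrite subsetEset => x; rewrite /I/= !in_itv/= => /andP[dx xd].
by rewrite (le_trans _ dx) ?lerD2l ?d_decr//= (le_trans xd) ?lerD2l ?lerN2 ?d_decr.
Qed.

Let bigcup_I : \bigcup_n I n = `]a, b[%classic.
Proof.
apply/seteqP; split => x.
  move=> [n _]; rewrite /I/= !in_itv/=; have [h1 h2 _] := d_bnd n.
  exact: sub_oo.
rewrite /= in_itv/= => /andP[ax xb].
have ba : 0 < b - a by rewrite subr_gt0.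
have e0 : 0 < Num.min (x - a) (b - x) by rewrite lt_min !subr_gt0 ax.
have := truncnS_gt ((b - a) / Num.min (x - a) (b - x)).
set n := Num.trunc _ => nE; exists n => //.
have : d n <= Num.min (x - a) (b - x).
  rewrite /d ler_pdivrMr ?ltr0n ?addnS// mulrC -ler_pdivrMr//.
  by apply: le_trans (ltW nE) _; rewrite ler_nat addn0 !ltnS ltnW.
rewrite le_min => /andP[h1 h2].
by rewrite /I/= in_itv/=; apply/andP; split; lra.
Qed.

(** Exhaustion by segments: the endpoints may be singular for [G], for [f], or both. *)
Lemma ge0_substitution_open :
  (\int[mu]_(t in F @` `]a, b[) (G t)%:E =
   \int[mu]_(x in `]a, b[) (G (F x) * f x)%:E)%E.
Proof.
have FI n : F @` I n = `[F (a + d n), F (b - d n)]%classic.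
  by have [h1 h2 h3] := d_bnd n; exact: imageF.
have Iab n x : I n x -> a < x < b.
  rewrite /I/= in_itv/=; have [h1 h2 _] := d_bnd n.
  exact: sub_oo.
have cGI n : {within F @` I n, continuous G}.
  apply: continuous_in_subspaceT => y.
  by rewrite inE/= => -[x] /Iab xab <-; exact: cG.
have cGFI n : {within I n, continuous (fun x => G (F x) * f x)}.
  apply: continuous_in_subspaceT => x; rewrite inE => /Iab xab.
  by apply: cvgM; [apply: continuous_comp; [exact: cF|exact: cG]|exact: cf].
have mI n : measurable (I n) by exact: measurable_itv.
have mFI n : measurable (F @` I n) by rewrite FI; exact: measurable_itv.
have c1 : (\int[mu]_(t in F @` I i) (G t)%:E @[i --> \oo] -->
           \int[mu]_(t in \bigcup_i (F @` I i)) (G t)%:E)%E.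
  apply: ge0_nondecreasing_set_cvg_integral => //.
  - by move=> m n mn; rewrite subsetEset; apply: image_subset; rewrite -subsetEset I_nd.
  - move=> n; apply/measurable_EFinP.
    exact: subspace_continuous_measurable_fun.
  - by move=> n _ [x /Iab xab <-]; rewrite lee_fin G_ge0.
have c2 : (\int[mu]_(x in I i) (G (F x) * f x)%:E @[i --> \oo] -->
           \int[mu]_(x in \bigcup_i I i) (G (F x) * f x)%:E)%E.
  apply: ge0_nondecreasing_set_cvg_integral => //.
  - move=> n; apply/measurable_EFinP.
    exact: subspace_continuous_measurable_fun.
  - move=> n x /Iab xab; rewrite lee_fin mulr_ge0 ?G_ge0//.
    exact/ltW/f_gt0.
rewrite -bigcup_I image_bigcup.
apply: cvg_unique c1 _ => //.
have -> : (fun i => \int[mu]_(t in F @` I i) (G t)%:E)%E =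
          (fun i => \int[mu]_(x in I i) (G (F x) * f x)%:E)%E.
  by apply/funext => n; have [h1 h2 h3] := d_bnd n; exact: substitution_segment.
exact: c2.
Qed.

End Substitution.

(** * Integrals of periodic functions *)

Section PeriodicIntegrals.
Local Open Scope ereal_scope.
Context {R : realType}.
Notation mu := (@lebesgue_measure R).
Implicit Types (f : R -> \bar R) (c : R).

Let shift c : measurableTypeR R -> measurableTypeR R := fun x => (x + c)%R.

Let measurable_shift c : measurable_fun setT (shift c).
Proof. exact: measurable_funD. Qed.

Lemma lebesgue_measure_shift c (A : set R) : measurable A ->
  pushforward mu (shift c) A = mu A.
Proof.
move=> mA.
pose mixin := isMeasurableFun.Build _ _ _ _ _ (measurable_shift c).
pose f : {mfun measurableTypeR R >-> measurableTypeR R} := HB.pack (shift c) mixin.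
rewrite -[LHS]/(pushforward mu f A).
apply/esym/(lebesgue_measure_unique (mu := pushforward mu f)) => //= _ [[a b]] _ <-.
rewrite /pushforward/= (_ : _ @^-1` _ = `]a - c, b - c]%classic)%R; last first.
  by apply/seteqP; split => x /=; rewrite !in_itv/= ltrBlDr lerBrDr.
rewrite !lebesgue_measure_itv/= !lte_fin ltrD2r.
by rewrite -!EFinD opprD opprK addrACA addNr addr0.
Qed.

Lemma ge0_integral_shift f c (a b : R) :
  measurable_fun setT f -> (forall x, 0 <= f x) ->
  \int[mu]_(x in `[a, b[) f (x + c)%R = \int[mu]_(x in `[(a + c)%R, (b + c)%R[) f x.
Proof.
move=> mf f0.
rewrite (_ : `[a, b[%classic = shift c @^-1` `[(a + c)%R, (b + c)%R[%classic); last first.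
  by apply/seteqP; split => x /=; rewrite !in_itv/= lerD2r ltrD2r.
rewrite -(@ge0_integral_pushforward _ _ _ _ _ _ (measurable_shift c) mu _ f)//; last exact: measurable_funS mf.
by apply: eq_measure_integral => //= A mA AS; exact: lebesgue_measure_shift.
Qed.

Lemma ge0_integral_oppr f (a b : R) :
  measurable_fun setT f -> (forall x, 0 <= f x) ->
  \int[mu]_(x in `]a, b[) f (- x)%R = \int[mu]_(x in `](- b)%R, (- a)%R[) f x.
Proof.
move=> mf f0.
have mN : measurable_fun setT (-%R : measurableTypeR R -> measurableTypeR R).
  exact: measurable_funN.
rewrite (_ : `]a, b[%classic = -%R @^-1` `](- b)%R, (- a)%R[%classic); last first.
  by apply/seteqP; split => x /=; rewrite !in_itv/= !ltrN2 andbC.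
rewrite -(@ge0_integral_pushforward _ _ _ _ _ _ mN mu _ f)//; last exact: measurable_funS mf.
by apply: eq_measure_integral => //= A mA AS; exact: lebesgue_measureN.
Qed.

Lemma ge0_integral_itv_split f (a b c : R) : (a <= b)%R -> (b <= c)%R ->
  measurable_fun setT f -> (forall x, 0 <= f x) ->
  \int[mu]_(x in `[a, c[) f x =
  \int[mu]_(x in `[a, b[) f x + \int[mu]_(x in `[b, c[) f x.
Proof.
move=> ab bc mf f0.
rewrite (@itv_bndbnd_setU _ _ (BLeft a) (BLeft b) (BLeft c)) ?bnd_simp//.
rewrite ge0_integral_setU//=; first exact: measurable_funTS.
rewrite disj_set2E; apply/eqP; rewrite -subset0 => x [] /=.
by rewrite !in_itv/= => /andP[_ xb] /andP[]; rewrite leNgt xb.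
Qed.

Lemma periodic_int f : (forall x, f (x + 1)%R = f x) ->
  forall x (k : int), f (x + k%:~R)%R = f x.
Proof.
move=> f1; have fn x n : f (x + n%:R)%R = f x.
  by elim: n => [|n IH]; rewrite ?addr0// -natr1 addrA f1.
move=> x [n|n]; first exact: fn.
by rewrite NegzE mulrNz -[in RHS](subrK n.+1%:R x) fn.
Qed.

(** Up to a multiple of the period the shift is some [r] in [0, 1), and the part of [r, 1 + r) beyond 1
    is the translate of [0, r). *)
Lemma ge0_integral_periodic f c :
  measurable_fun setT f -> (forall x, 0 <= f x) -> (forall x, f (x + 1)%R = f x) ->
  \int[mu]_(x in `[0%R, 1%R[) f (x + c)%R = \int[mu]_(x in `[0%R, 1%R[) f x.
Proof.
move=> mf f0 f1.
pose r : R := (c - (Num.floor c)%:~R)%R.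
have /andP[r0 r1] : (0 <= r < 1)%R.
  have /andP[h1 h2] := floor_itv c.
  by rewrite /r subr_ge0 h1/= ltrBlDl -[X in (_ < _ + X)%R]/(1%:~R) -intrD.
have -> : (fun x => f (x + c)%R) = (fun x => f (x + r)%R).
  apply/funext => x; rewrite -(periodic_int f1 (x + r)%R (Num.floor c)).
  by rewrite /r -addrA subrK.
rewrite ge0_integral_shift// add0r.
rewrite (@ge0_integral_itv_split _ _ 1%R)//; [|exact: ltW|by rewrite lerDl].
rewrite [in RHS](@ge0_integral_itv_split _ _ r)//; last exact: ltW.
rewrite addeC; congr (_ + _).
have := @ge0_integral_shift f 1 0 r mf f0.
rewrite add0r addrC => <-.
by apply: eq_integral => x _; exact: f1.
Qed.

Lemma ge0_integral_symm f :
  measurable_fun setT f -> (forall x, 0 <= f x) -> (forall x, f (1 - x)%R = f x) ->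
  \int[mu]_(x in `[0%R, 1%R[) f x = 2%:E * \int[mu]_(x in `]0%R, (1 / 2)%R[) f x.
Proof.
move=> mf f0 f1.
have h0 : (0 <= 1 / 2 :> R)%R by rewrite divr_ge0.
have h1 : (1 / 2 <= 1 :> R)%R by rewrite ler_pdivrMr// mul1r ler1n.
rewrite (@ge0_integral_itv_split _ _ (1 / 2)%R)//.
have mft (A : set R) : measurable A -> measurable_fun A f.
  by move=> _; exact: measurable_funTS.
rewrite integral_itv_bndoo; last exact: mft.
have -> : 2%:E = 1 + 1 :> \bar R by rewrite -EFinD; congr EFin; ring.
rewrite ge0_muleDl ?lee_fin// !mul1e; congr (_ + _).
pose g x := f (x + 1)%R.
have mg : measurable_fun setT g.
  by apply: measurableT_comp mf _; exact: measurable_funD.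
transitivity (\int[mu]_(x in `]0%R, (1 / 2)%R[) g (- x)%R); last first.
  by apply: eq_integral => x _; rewrite /g addrC f1.
rewrite ge0_integral_oppr//; last by move=> x; exact: f0.
rewrite oppr0 -(@integral_itv_bndoo _ _ _ _ true true); last exact: measurable_funTS.
rewrite /g ge0_integral_shift// add0r.
by rewrite (_ : - (1 / 2) + 1 = 1 / 2)%R//; field.
Qed.

End PeriodicIntegrals.

(** * The law of the three angles *)

(** The measurable rectangles generate the product sigma-algebra and are stable under intersection. *)
Lemma finite_measure_prod_unique {R : realType} {d1 d2 : measure_display}
    {T1 : measurableType d1} {T2 : measurableType d2}
    (m1 m2 : {measure set (T1 * T2) -> \bar R}) :
  (m1 setT < +oo)%E ->
  (forall A B, measurable A -> measurable B -> m1 (A `*` B) = m2 (A `*` B)) ->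
  forall X, measurable X -> m1 X = m2 X.
Proof.
move=> m1oo m12 X mX.
pose C : set (set (T1 * T2)) :=
  [set C | exists A, measurable A /\ exists B, measurable B /\ C = A `*` B].
apply: (measure_unique C (fun=> setT)) => //.
- rewrite measurable_prod_measurableType //; congr (<<s _ >>).
  rewrite predeqE; split => [[A mA [B mB <-]]|[A [mA [B [mB ->]]]]].
    by exists A; split => //; exists B.
  by exists A => //; exists B.
- move=> /= _ _ [X1 [mX1 [X2 [mX2 ->]]]] [Y1 [mY1 [Y2 [mY2 ->]]]].
  rewrite -setXI; exists (X1 `&` Y1); split; first exact: measurableI.
  by exists (X2 `&` Y2); split => //; exact: measurableI.
- by move=> n; exists setT; split => //; exists setT; split => //; rewrite setXTT.
- by rewrite bigcup_const//; exists 0%N.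
- by move=> A [A1 [mA1 [A2 [mA2 ->]]]]; exact: m12.
Qed.

Section JointLaw.
Context {R : realType} {d : measure_display} {T : measurableType d}.
Context {P : probability T R} {U : 'I_3 -> {RV P >-> R}}.
Hypothesis indepU : mutually_independent U.
Hypothesis unifU : forall k : 'I_3, uniformly_distributed01 (U k).

Notation mu := (uniform_prob (@ltr01 R)).
Local Notation o0 := (@ord0 2).
Local Notation o1 := (@Ordinal 3 1 isT).
Local Notation o2 := (@Ordinal 3 2 isT).

Lemma joint_rectangle (A B C : set R) :
  measurable A -> measurable B -> measurable C ->
  P (U o2 @^-1` A `&` (U o1 @^-1` B `&` U o0 @^-1` C)) = (mu A * (mu B * mu C))%E.
Proof.
move=> mA mB mC.
pose D (i : 'I_3) := if i == o2 then A else if i == o1 then B else C.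
have mD i : measurable (D i) by rewrite /D; do 2 case: ifP => // _.
have := indepU mD.
rewrite !big_ord_recl big_ord0 mule1.
have -> : \bigcap_(i in [set: 'I_3]) (U i @^-1` D i) =
    U o2 @^-1` A `&` (U o1 @^-1` B `&` U o0 @^-1` C).
  apply/seteqP; split=> [w Dw|w [wA [wB wC]] [[|[|[|//]]] i3] _].
  - by split; [exact: (Dw o2)|split; [exact: (Dw o1)|exact: (Dw o0)]].
  - by rewrite (_ : Ordinal i3 = o0)//; exact: val_inj.
  - by rewrite (_ : Ordinal i3 = o1)//; exact: val_inj.
  - by rewrite (_ : Ordinal i3 = o2)//; exact: val_inj.
have -> : lift ord0 ord0 = o1 :> 'I_3 by exact: val_inj.
have -> : lift ord0 (lift ord0 ord0) = o2 :> 'I_3 by exact: val_inj.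
rewrite /D/= => ->; rewrite -(unifU o2 mA) -(unifU o1 mB) -(unifU o0 mC).
rewrite /distribution /pushforward /=.
by rewrite muleC -muleA muleCA.
Qed.

Notation Rm := (measurableTypeR R).

Let U10 (w : T) : Rm * Rm := (U o1 w, U o0 w).
Let U210 (w : T) : Rm * (Rm * Rm) := (U o2 w, U10 w).

Let mU k : measurable_fun setT (U k : T -> Rm).
Proof. exact: (measurable_funP (U k)). Qed.

Let mU10 : measurable_fun setT U10.
Proof. by apply/measurable_fun_pair; exact: mU. Qed.

Let mU210 : measurable_fun setT U210.
Proof. by apply/measurable_fun_pair; [exact: mU|exact: mU10]. Qed.

Let mu2 : probability (Rm * Rm)%type R := (mu \x mu)%E.
Let mu3 : probability (Rm * (Rm * Rm))%type R := (mu \x mu2)%E.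

(* for a fixed A both sides are finite measures in X that agree on rectangles *)
Let law_slice (A : set Rm) : measurable A -> forall X : set (Rm * Rm), measurable X ->
  P (U o2 @^-1` A `&` U10 @^-1` X) = (mu A * (mu \x mu) X)%E.
Proof.
move=> mA X mX.
have mUA : measurable (U o2 @^-1` A).
  by rewrite -[X in measurable X]setTI; exact: measurable_funP.
pose m1 : {measure set (Rm * Rm) -> \bar R} := pushforward (mrestr P mUA) U10.
have muA : mu A \is a fin_num by rewrite fin_num_measure.
have muA0 : 0 <= fine (mu A) by rewrite fine_ge0.
pose m2 : {measure set (Rm * Rm) -> \bar R} := mscale (NngNum muA0) (mu \x mu)%E.
have m2E Y : m2 Y = (mu A * (mu \x mu) Y)%E.
  by rewrite -[LHS]/((fine (mu A))%:E * (mu \x mu) Y)%E fineK.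
rewrite -m2E.
rewrite setIC -[LHS]/(m1 mU10 X).
apply: (@finite_measure_prod_unique _ _ _ _ _ (m1 mU10) m2) mX.
  rewrite /m1 /= /pushforward preimage_setT /mrestr setTI.
  by rewrite (le_lt_trans (probability_le1 _ _))// ltry.
move=> B C mB mC; rewrite m2E product_measure1E//.
rewrite -joint_rectangle// setIC; congr (P _).
Qed.

Let joint_law (X : set (Rm * (Rm * Rm))) : measurable X ->
  P (U210 @^-1` X) = mu3 X.
Proof.
move=> mX; pose m1 : {measure set (Rm * (Rm * Rm)) -> \bar R} := pushforward P U210.
apply: (@finite_measure_prod_unique _ _ _ _ _ (m1 mU210) mu3) mX.
  by rewrite /m1 /= /pushforward preimage_setT probability_setT ltry.
move=> A B mA mB; rewrite -[RHS]/((mu \x mu2)%E (A `*` B)) product_measure1E//.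
exact: (law_slice mA mB).
Qed.

Lemma joint_integral (f : Rm * (Rm * Rm) -> \bar R) :
  measurable_fun setT f -> (forall x, 0 <= f x)%E ->
  (\int[P]_w f (U o2 w, (U o1 w, U o0 w)) =
   \int[mu]_x \int[mu]_y \int[mu]_z f (x, (y, z)))%E.
Proof.
move=> mf f0.
transitivity (\int[pushforward P U210]_v f v)%E.
  by rewrite ge0_integral_pushforward.
transitivity (\int[mu3]_v f v)%E.
  by apply: eq_measure_integral => A mA _; exact: joint_law.
rewrite fubini_tonelli1//; apply: eq_integral => x _.
rewrite /fubini_F fubini_tonelli1//.
exact: measurableT_comp.
Qed.

End JointLaw.

(** * Two angles suffice *)

Section TwoAngles.
Local Open Scope ereal_scope.
Context {R : realType}.
Notation Rm := (measurableTypeR R).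
Notation mu := (@lebesgue_measure R).
Notation unif := (uniform_prob (@ltr01 R)).

Lemma integral_uniform01 (f : R -> \bar R) :
  measurable_fun setT f -> (forall x, 0 <= f x) ->
  \int[unif]_x f x = \int[mu]_(x in `[0%R, 1%R[) f x.
Proof.
move=> mf f0; rewrite integral_uniform// subr0 invr1 mul1e.
by rewrite integral_itv_bndo_bndc//; exact: measurable_funTS.
Qed.

Definition cos1 (x : R) : R := cos (2 * pi * x).

Lemma cos1D1 (x : R) : (cos1 (x + 1) = cos1 x)%R.
Proof. by rewrite /cos1 mulrDr mulr1 mulr_natl cosD2pi. Qed.

Lemma cos1N (x : R) : (cos1 (- x) = cos1 x)%R.
Proof. by rewrite /cos1 mulrN cosN. Qed.

Lemma cos1Dhalf (x : R) : (cos1 (x + 1 / 2) = - cos1 x)%R.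
Proof.
rewrite /cos1 (_ : 2 * pi * (x + 1 / 2) = 2 * pi * x + pi)%R ?cosDpi//.
by field.
Qed.

Lemma measurable_cos1 : measurable_fun setT cos1.
Proof.
apply: continuous_measurable_fun => x.
by notypeclasses refine (is_derive_continuous _); rewrite /cos1;
   notypeclasses refine (is_derive_comp _ _); [exact: is_derive_cos|derive_rec].
Qed.

(** The squared length of the sum of the unit vectors at angles [2 pi x], [2 pi y], [2 pi z]. *)
Definition walk_sqr (x y z : R) : R :=
  (3 + 2 * cos1 (z - y) + 2 * cos1 (y - x) + 2 * cos1 (z - x))%R.

(** The squared distance after two steps in directions that differ by [2 pi z] is [r^2] with
    [r = 2 cos (pi z)], and the third step makes the angle [2 pi y] with minus their sum. *)
Definition triangle_sqr (z y : R) : R :=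
  (1 + (2 * cos (pi * z)) ^+ 2 - 2 * (2 * cos (pi * z)) * cos1 y)%R.

Lemma walk_sqrE x y z :
  walk_sqr x (y + (x - z / 2 + 1 / 2)) (z + (y + (x - z / 2 + 1 / 2))) =
  triangle_sqr z y.
Proof.
rewrite /walk_sqr /triangle_sqr /cos1.
set a := (2 * pi * y + pi)%R; set b := (pi * z)%R.
have -> : (2 * pi * (z + (y + (x - z / 2 + 1 / 2)) - (y + (x - z / 2 + 1 / 2))) = b + b)%R.
  by rewrite /b; field.
have -> : (2 * pi * (y + (x - z / 2 + 1 / 2) - x) = a - b)%R by rewrite /a /b; field.
have -> : (2 * pi * (z + (y + (x - z / 2 + 1 / 2)) - x) = a + b)%R.
  by rewrite /a /b; field.
have -> : cos (2 * pi * y) = (- cos a)%R by rewrite /a cosDpi opprK.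
clearbody a b; rewrite !cosD !cosN !sinN.
have := cos2Dsin2 b; set c := cos b; set s := sin b => cs.
have s2 : (s * s = 1 - c ^+ 2)%R by rewrite -cs; ring.
by rewrite s2; ring.
Qed.

Lemma measurable_walk_sqr :
  measurable_fun setT (fun v : Rm * (Rm * Rm) => walk_sqr v.1 v.2.1 v.2.2 : Rm).
Proof.
have m1 (f : Rm * (Rm * Rm) -> Rm) : measurable_fun setT f ->
    measurable_fun setT (fun v => 2 * cos1 (f v) : Rm)%R.
  move=> mf; apply: measurable_funM => //.
  exact: (measurableT_comp measurable_cos1).
rewrite /walk_sqr; apply: measurable_funD; [apply: measurable_funD; [apply: measurable_funD|]|];
  [exact: measurable_cst|apply: m1..].
- apply: measurable_funB; apply: (measurableT_comp _ measurable_snd).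
  + exact: measurable_snd.
  + exact: measurable_fst.
- apply: measurable_funB; last exact: measurable_fst.
  exact: (measurableT_comp measurable_fst measurable_snd).
- apply: measurable_funB; last exact: measurable_fst.
  exact: (measurableT_comp measurable_snd measurable_snd).
Qed.

Lemma measurable_triangle_sqr :
  measurable_fun setT (fun v : Rm * Rm => triangle_sqr v.1 v.2 : Rm).
Proof.
have mr : measurable_fun setT (fun v : Rm * Rm => 2 * cos (pi * v.1) : Rm)%R.
  apply: measurable_funM => //; apply: (measurableT_comp (continuous_measurable_fun (@continuous_cos R))).
  by apply: measurable_funM => //; exact: measurable_fst.
rewrite /triangle_sqr; apply: measurable_funB.
  by apply: measurable_funD => //; exact: measurable_funX.
apply: measurable_funM; last exact: (measurableT_comp measurable_cos1 measurable_snd).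
exact: measurable_funM.
Qed.

Lemma integral_uniform_periodic (f : Rm -> \bar R) c :
  measurable_fun setT f -> (forall x, 0 <= f x) -> (forall x, f (x + 1)%R = f x) ->
  \int[unif]_x f (x + c)%R = \int[unif]_x f x.
Proof.
move=> mf f0 f1; rewrite !integral_uniform01 ?ge0_integral_periodic//.
by apply: measurableT_comp mf _; exact: measurable_funD.
Qed.

Variable g : R -> \bar R.
Hypothesis mg : measurable_fun setT g.
Hypothesis g_ge0 : forall x, 0 <= g x.

Let mgw {d : measure_display} {T : measurableType d} (a b c : T -> Rm) :
  measurable_fun setT a -> measurable_fun setT b -> measurable_fun setT c ->
  measurable_fun setT (fun t => g (walk_sqr (a t) (b t) (c t))).
Proof.
move=> ma mb mc.
have mabc : measurable_fun setT (fun t => (a t, (b t, c t))).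
  by apply/measurable_fun_pair => //; apply/measurable_fun_pair.
exact: (measurableT_comp (measurableT_comp mg measurable_walk_sqr) mabc).
Qed.

Let mgt : measurable_fun setT (fun v : Rm * Rm => g (triangle_sqr v.1 v.2)).
Proof. exact: (measurableT_comp mg measurable_triangle_sqr). Qed.

Let mgtz (z : Rm) : measurable_fun setT (fun y : Rm => g (triangle_sqr z y)).
Proof. exact: (measurableT_comp mgt (measurable_pair1 z)). Qed.

(** Invariance under translation lets [z + y] replace [z] and then, after exchanging the integrals,
    [y + (x - z / 2 + 1 / 2)] replace [y]; by [walk_sqrE] the integrand no longer depends on [x]. *)
Let two_angles_fixed x :
  \int[unif]_y \int[unif]_z g (walk_sqr x y z) =
  \int[unif]_z \int[unif]_y g (triangle_sqr z y).
Proof.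
transitivity (\int[unif]_y \int[unif]_z g (walk_sqr x y (z + y)%R)).
  apply: eq_integral => y _.
  rewrite (@integral_uniform_periodic (fun z => g (walk_sqr x y z)))//.
    exact: mgw.
  by move=> z; rewrite /walk_sqr !(addrAC z 1%R) !cos1D1.
rewrite (@fubini_tonelli _ _ Rm Rm R unif unif (fun v => g (walk_sqr x v.1 (v.2 + v.1)%R)))//; last first.
  apply: mgw; [exact: measurable_cst|exact: measurable_fst|].
  by apply: measurable_funD; [exact: measurable_snd|exact: measurable_fst].
apply: eq_integral => z _ /=.
rewrite -(@integral_uniform_periodic _ (x - z / 2 + 1 / 2)%R)//.
- by apply: eq_integral => y _; rewrite walk_sqrE.
- by apply: mgw => //; exact: measurable_funD.
- move=> y; rewrite /walk_sqr; congr g.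
  rewrite (_ : z + (y + 1) - (y + 1) = z + y - y)%R; last by ring.
  rewrite (_ : y + 1 - x = (y - x) + 1)%R; last by ring.
  by rewrite (_ : z + (y + 1) - x = (z + y - x) + 1)%R ?cos1D1//; ring.
Qed.

(** The reflections [y -> 1 - y] and [z -> 1 - z], the second one combined with the translation
    [y -> y + 1 / 2], reduce both angles to half a period. *)
Lemma two_angles :
  \int[unif]_x \int[unif]_y \int[unif]_z g (walk_sqr x y z) =
  4%:E * \int[mu]_(z in `]0%R, (1 / 2)%R[) \int[mu]_(y in `]0%R, (1 / 2)%R[) g (triangle_sqr z y).
Proof.
transitivity (\int[unif]_z \int[unif]_y g (triangle_sqr z y)).
  transitivity (\int[unif]_(x in setT)
      (cst (\int[unif]_z \int[unif]_y g (triangle_sqr z y))) x).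
    by apply: eq_integral => x _; exact: two_angles_fixed.
  have unif1 : unif setT = 1 by exact: (@probability_setT _ _ _ (unif : probability Rm R)).
  by rewrite integral_cst// [X in _ * X]unif1 mule1.
pose h (z : Rm) := \int[unif]_y g (triangle_sqr z y).
have mh : measurable_fun setT h.
  exact: (@measurable_fun_fubini_tonelli_F _ _ Rm Rm R unif (fun v => g (triangle_sqr v.1 v.2))).
have h0 z : 0 <= h z by exact: integral_ge0.
have hE z : h z = 2%:E * \int[mu]_(y in `]0%R, (1 / 2)%R[) g (triangle_sqr z y).
  rewrite /h (integral_uniform01 (mgtz z))//.
  apply: (@ge0_integral_symm R (fun y => g (triangle_sqr z y))) => //.
    exact: mgtz.
  by move=> y; rewrite /triangle_sqr [(1 - y)%R]addrC cos1D1 cos1N.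
have symm_h z : h (1 - z)%R = h z.
  rewrite /h -(@integral_uniform_periodic (fun y => g (triangle_sqr z y)) (1 / 2)%R)//.
    apply: eq_integral => y _; congr g; rewrite /triangle_sqr cos1Dhalf.
    rewrite (_ : pi * (1 - z) = - (pi * z) + pi)%R ?cosDpi ?cosN; last by ring.
    by ring.
  by move=> y; rewrite /triangle_sqr cos1D1.
rewrite (integral_uniform01 mh)// (ge0_integral_symm mh h0 symm_h).
rewrite (_ : 4 = 2 * 2 :> R)%R; last by ring.
rewrite EFinM -muleA; congr (_ * _).
rewrite -ge0_integralZl//.
- by apply: eq_integral => z _; rewrite hE.
- apply: measurable_funTS.
  have half (t : \bar R) : t = (1 / 2)%:E * (2%:E * t).
    by rewrite muleA -EFinM (_ : 1 / 2 * 2 = 1)%R ?mul1e//; field.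
  rewrite (_ : (fun z => _) = (fun z => (1 / 2)%:E * h z)).
    exact: measurable_funeM.
  by apply/funext => z; rewrite hE -half.
- by move=> z _; exact: integral_ge0.
Qed.

End TwoAngles.

(** * The third side of a triangle with sides 1 and [r] *)

Section ThirdSide.
Context {R : realType}.
Notation mu := (@lebesgue_measure R).
Implicit Types (r x y a b : R).

(** By Heron's formula this is 16 times the squared area of the triangle with sides 1, [r], [x]. *)
Definition heron r x : R := ((1 + r) ^+ 2 - x ^+ 2) * (x ^+ 2 - (1 - r) ^+ 2).

(** By the law of cosines, [side_kernel r x / (2 pi)] is the derivative in [x] of the angle, in turns,
    opposite to the side [x]. It is 0 if there is no such triangle, because the square root of a
    negative number and the inverse of 0 are 0. *)
Definition side_kernel r x : R := 2 * `|x| * (Num.sqrt (heron r x))^-1.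

Lemma side_kernel_ge0 r x : 0 <= side_kernel r x.
Proof. by rewrite mulr_ge0 ?mulr_ge0 ?invr_ge0 ?sqrtr_ge0. Qed.

Lemma side_kernel_le0 r x : heron r x <= 0 -> side_kernel r x = 0.
Proof. by move=> h; rewrite /side_kernel ler0_sqrtr// invr0 mulr0. Qed.

(* positive sums of pairs mean that at most one of the three numbers is nonpositive *)
Let mul3_gt0 (p q s : R) : 0 < p + q -> 0 < p + s -> 0 < q + s ->
  (0 < p * (q * s)) = [&& 0 < p, 0 < q & 0 < s].
Proof.
move=> pq ps qs.
have [p0|p0] := ltP 0 p; last first.
  by apply/negbTE; rewrite -leNgt; apply: mulr_le0_ge0 => //; apply: mulr_ge0; lra.
rewrite pmulr_rgt0//=.
have [q0|q0] := ltP 0 q; first by rewrite pmulr_rgt0.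
by apply/negbTE; rewrite -leNgt mulr_le0_ge0//; lra.
Qed.

Lemma heron_gt0 r x : 0 < r -> 0 < x ->
  (0 < heron r x) = (`|1 - r| < x < 1 + r).
Proof.
move=> r0 x0; rewrite /heron.
have -> : ((1 + r) ^+ 2 - x ^+ 2) * (x ^+ 2 - (1 - r) ^+ 2) =
  (1 + r + x) * ((1 + r - x) * ((x - (1 - r)) * (x + (1 - r)))) by ring.
have h1 : 0 < 1 + r + x by lra.
rewrite (pmulr_rgt0 _ h1) mul3_gt0; try lra.
rewrite ltr_norml; apply/idP/idP => [/and3P[? ? ?]|/andP[/andP[? ?] ?]].
  by apply/andP; split; [apply/andP; split|]; lra.
by apply/and3P; split; lra.
Qed.

Let angle r x : R := acos ((1 + r ^+ 2 - x ^+ 2) / (2 * r)) / (2 * pi).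

Let cos_angle_lt1 r x : 0 < r -> 0 < heron r x ->
  -1 < (1 + r ^+ 2 - x ^+ 2) / (2 * r) < 1.
Proof.
move=> r0 h0; rewrite -ltr_norml -(@expr_lt1 _ 2)// real_normK ?num_real//.
have -> : ((1 + r ^+ 2 - x ^+ 2) / (2 * r)) ^+ 2 = 1 - heron r x / (2 * r) ^+ 2.
  by rewrite /heron; field; rewrite gt_eqF.
by rewrite gtrBl divr_gt0// exprn_gt0// mulr_gt0.
Qed.

Let is_derive_angle r x : 0 < r -> 0 < x -> 0 < heron r x ->
  is_derive x 1 (angle r) (side_kernel r x / (2 * pi)).
Proof.
move=> r0 x0 h0; rewrite /angle.
have pi0 := pi_gt0 R.
derive.
  notypeclasses refine (is_derive_comp _ _).
    by apply: is_derive1_acos; exact: cos_angle_lt1.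
  derive_rec.
have -> : 1 - ((1 + r ^+ 2 - x ^+ 2) / (2 * r)) ^+ 2 = heron r x / (2 * r) ^+ 2.
  by rewrite /heron; field; rewrite gt_eqF.
have r20 : 0 <= 2 * r by rewrite mulr_ge0// ltW.
rewrite sqrtrM ?ltW// sqrtrV ?sqr_ge0// sqrtr_sqr ger0_norm// /side_kernel.
rewrite gtr0_norm//.
have s0 : Num.sqrt (heron r x) != 0 by rewrite gt_eqF// sqrtr_gt0.
move: (pi : R) pi0 => p p0; move: s0; set s := Num.sqrt _ => s0.
by field; rewrite s0 (gt_eqF p0) (gt_eqF r0).
Qed.

Let continuous_near_eq (f g : R -> R) x : {near x, f =1 g} -> {for x, continuous g} -> {for x, continuous f}.
Proof.
move=> fg; rewrite /prop_for /continuous_at (nbhs_singleton fg).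
by apply: cvg_trans; apply: near_eq_cvg; apply: filterS fg => y ->.
Qed.

Lemma continuous_side_kernel r x : 0 < x -> 0 < heron r x -> {for x, continuous (side_kernel r)}.
Proof.
move=> x0 h0; apply: (@continuous_near_eq _ (fun x => 2 * x * (Num.sqrt (heron r x))^-1)).
  by near=> y; rewrite /side_kernel gtr0_norm//; near: y; exact: lt_nbhsr.
notypeclasses refine (is_derive_continuous _); derive_rec; first exact: h0.
by rewrite /heron; derive_rec.
Unshelve. all: by end_near. Qed.

Lemma cos_oo (t : R) : 0 < t < pi -> -1 < cos t < 1.
Proof.
move=> t0; have s0 := sin_gt0_pi t0.
rewrite -ltr_norml -(@expr_lt1 _ 2)// real_normK ?num_real// cos2sin2.
by rewrite gtrBl exprn_gt0.
Qed.

Lemma acos_oo (t : R) : -1 < t < 1 -> 0 < acos t < pi.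
Proof.
by move=> /andP[t1 t2]; rewrite acos_gt0 ?acos_ltpi// ?t1 ?t2 ltW.
Qed.

Let image_angle r a b : 0 < r -> 0 <= a -> 0 <= b ->
  angle r @` `]Num.max a `|1 - r|, Num.min b (1 + r)[ =
  [set y | 0 < y < 1 / 2 /\ a ^+ 2 < 1 + r ^+ 2 - 2 * r * cos (2 * pi * y) < b ^+ 2].
Proof.
move=> r0 a0 b0; have pi0 := pi_gt0 R.
have pi20 : 0 < 2 * pi :> R by rewrite mulr_gt0.
apply/seteqP; split => [_ [x /= + <-]|y /= [y01]].
  rewrite in_itv/= gt_max lt_min => /andP[/andP[ax rx] /andP[xb xr]].
  have x0 : 0 < x by exact: le_lt_trans ax.
  have h0 : 0 < heron r x by rewrite heron_gt0// rx.
  have u1 := cos_angle_lt1 r0 h0.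
  split.
    have /andP[h1 h2] := acos_oo u1.
    rewrite /angle divr_gt0//= ltr_pdivrMr// (_ : 1 / 2 * (2 * pi) = pi)//.
    by move: (pi : R) => p; field.
  rewrite /angle (mulrC (2 * pi)) divfK ?gt_eqF// acosK; last first.
    by case/andP: u1 => ? ?; rewrite in_itv/= !ltW.
  rewrite (_ : _ - _ = x ^+ 2); last by field; rewrite gt_eqF.
  by rewrite !ltrXn2r ?qualifE/= ?(ltW x0) ?(le_trans (ltW x0) (ltW xb)).
have typi : 0 < 2 * pi * y < pi.
  case/andP: y01 => y0 y1; rewrite mulr_gt0//=.
  by rewrite mulrAC gtr_pMl//; lra.
have /andP[c1 c2] := cos_oo typi.
set c := cos _ in c1 c2 *; move=> /andP[aT Tb].
pose T := 1 + r ^+ 2 - 2 * r * c.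
have T1 : (1 - r) ^+ 2 < T by rewrite /T; nra.
have T2 : T < (1 + r) ^+ 2 by rewrite /T; nra.
have T0 : 0 <= T by rewrite (le_trans _ (ltW T1))// sqr_ge0.
have xT : Num.sqrt T ^+ 2 = T by rewrite sqr_sqrtr.
have x0 := sqrtr_ge0 T.
exists (Num.sqrt T).
  rewrite /= in_itv/= gt_max lt_min.
  have lt_sqrt u : 0 <= u -> (u < Num.sqrt T) = (u ^+ 2 < T).
    by move=> u0; rewrite -{2}xT ltr_pXn2r ?qualifE.
  have sqrt_lt u : 0 <= u -> (Num.sqrt T < u) = (T < u ^+ 2).
    by move=> u0; rewrite -{2}xT ltr_pXn2r ?qualifE.
  rewrite !lt_sqrt// !sqrt_lt ?addr_ge0 ?(ltW r0)// aT Tb T2 real_normK ?num_real//.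
  by rewrite T1.
rewrite /angle xT (_ : (1 + r ^+ 2 - T) / (2 * r) = c).
  rewrite /c cosK; last by case/andP: typi => ? ?; rewrite in_itv/= !ltW.
  by rewrite mulrC mulKf// gt_eqF.
by rewrite /T; field; rewrite gt_eqF.
Qed.

(** The angles for which the third side lies between [a] and [b] form the image, under the angle as a
    function of the third side, of an interval; its measure is the integral of the derivative. *)
Lemma integral_third_side r a b : 0 < r -> 0 <= a -> 0 <= b ->
  (\int[mu]_(y in `]0%R, (1 / 2)%R[)
     (\1_(`]a ^+ 2, b ^+ 2[%classic) (1 + r ^+ 2 - 2 * r * cos (2 * pi * y)))%:E =
   \int[mu]_(x in `]a, b[) (side_kernel r x / (2 * pi))%:E)%E.
Proof.
move=> r0 a0 b0.
pose D : set R := `]Num.max a `|1 - r|, Num.min b (1 + r)[%classic.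
have DE x : D x -> [/\ 0 < x & 0 < heron r x].
  rewrite /D/= in_itv/= gt_max lt_min => /andP[/andP[ax rx] /andP[xb xr]].
  have x0 : 0 < x by exact: le_lt_trans ax.
  by rewrite heron_gt0// rx.
transitivity (\int[mu]_(y in angle r @` D) (cst 1 y)%:E)%E.
  rewrite image_angle//.
  pose S := [set y | a ^+ 2 < 1 + r ^+ 2 - 2 * r * cos (2 * pi * y) < b ^+ 2].
  have -> : [set y | 0 < y < 1 / 2 /\
      a ^+ 2 < 1 + r ^+ 2 - 2 * r * cos (2 * pi * y) < b ^+ 2] = `]0, 1 / 2[ `&` S.
    by apply/seteqP; split => y; rewrite /S/= in_itv.
  rewrite integral_mkcondr; apply: eq_integral => y _.
  rewrite patchE indicE /S; case: ifPn => [|/negP].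
    by rewrite inE/= => yS; rewrite mem_set//= in_itv/=.
  by rewrite inE/= => yS; rewrite memNset//= in_itv/=; exact/negP.
transitivity (\int[mu]_(x in D) (side_kernel r x / (2 * pi))%:E)%E; last first.
  rewrite (_ : D = `]a, b[ `&` `]`|1 - r|, 1 + r[); last first.
    apply/seteqP; split => x; rewrite /D/= !in_itv/= gt_max lt_min.
      by move=> /andP[/andP[-> ->] /andP[-> ->]].
    by move=> [/andP[-> ->] /andP[-> ->]].
  rewrite integral_mkcondr; apply: eq_integral => x.
  rewrite inE/= in_itv/= => /andP[ax xb]; rewrite patchE.
  case: ifPn => //; rewrite notin_setE/= in_itv/= => /negP xn.
  rewrite side_kernel_le0 ?mul0r// leNgt heron_gt0//.
  exact: le_lt_trans ax.
have [ab|ba] := ltP (Num.max a `|1 - r|) (Num.min b (1 + r)); last first.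
  by rewrite /D set_itv_ge ?image_set0 ?integral_set0// bnd_simp -leNgt.
have DI x : Num.max a `|1 - r| < x < Num.min b (1 + r) -> D x by rewrite /D/= in_itv.
have dF x (xD : Num.max a `|1 - r| < x < Num.min b (1 + r)) :
    is_derive x 1 (angle r) (side_kernel r x / (2 * pi)).
  by have [x0 h0] := DE x (DI x xD); exact: is_derive_angle.
rewrite (ge0_substitution_open ab dF).
- by apply: eq_integral => x _; rewrite /= mul1r.
- move=> x /DI/DE[x0 h0]; rewrite divr_gt0 ?mulr_gt0 ?pi_gt0//.
  by rewrite normr_gt0 gt_eqF.
  by rewrite invr_gt0 sqrtr_gt0.
- by move=> x /DI/DE[x0 h0]; apply: cvgMr_tmp; exact: continuous_side_kernel.
- by move=> x _; exact: cvg_cst.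
- by [].
Qed.

End ThirdSide.

(** * The distance after two steps *)

(** The hypotheses say that [4] and [(1 + x)^2] are, up to order, [k^2] times [4] and [(1 + y)^2], and
    that [(1 - x)^2] is [k^2 (1 - y)^2]. So [r^2 = k^2 (1 + y^2 + 2 y cos s)] runs, for [s] between 0
    and [pi], over the squared distances [r^2 < 4] for which the third distance [x] is possible. They
    hold for [y = x], [k = 1] when [x < 1], and for [y = (3 - x) / (1 + x)], [k = (1 + x) / 2] when
    [1 < x < 3], where [4] is the smaller one of the two upper bounds. *)
Section SecondStep.
Context {R : realType}.
Notation mu := (@lebesgue_measure R).
Variables x y k : R.
Hypotheses (x_gt0 : 0 < x) (y_gt0 : 0 < y) (y_lt1 : y < 1) (k_gt0 : 0 < k).
Hypothesis sum_roots : (1 + x) ^+ 2 + 4 = k ^+ 2 * (1 + y) ^+ 2 + 4 * k ^+ 2.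
Hypothesis prod_roots : (1 + x) ^+ 2 * 4 = k ^+ 2 * (1 + y) ^+ 2 * (4 * k ^+ 2).
Hypothesis low_root : (1 - x) ^+ 2 = k ^+ 2 * (1 - y) ^+ 2.

Let r2 (s : R) : R := k ^+ 2 * (1 + y ^+ 2 + 2 * y * cos s).

Let turn (s : R) : R := acos (Num.sqrt (r2 s) / 2) / pi.

Let roots (u : R) : ((1 + x) ^+ 2 - u) * (4 - u) =
  (k ^+ 2 * (1 + y) ^+ 2 - u) * (4 * k ^+ 2 - u).
Proof.
have -> : ((1 + x) ^+ 2 - u) * (4 - u) =
  (1 + x) ^+ 2 * 4 - ((1 + x) ^+ 2 + 4) * u + u ^+ 2 by ring.
by rewrite prod_roots sum_roots; ring.
Qed.

Let big_root : k ^+ 2 * (1 + y) ^+ 2 < 4 * k ^+ 2.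
Proof.
have k2 : 0 < k ^+ 2 by rewrite exprn_gt0.
by move: y_gt0 y_lt1 => y0 y1; rewrite mulrC ltr_pM2r//; nra.
Qed.

(* of the two upper bounds 4 and (1 + x)^2 for r^2, k^2 (1 + y)^2 is the smaller *)
Let upper u : (u < k ^+ 2 * (1 + y) ^+ 2) = (u < 4) && (u < (1 + x) ^+ 2).
Proof.
have := roots u; have := big_root; have := sum_roots.
move: (k ^+ 2 * (1 + y) ^+ 2) (4 * k ^+ 2) ((1 + x) ^+ 2) => p q v vpq pq E.
apply/idP/andP => [up|[u4 uv]].
  have h : 0 < (v - u) * (4 - u) by rewrite E mulr_gt0//; lra.
  have [u4|u4] := ltP u 4.
    by split=> //; move: h; rewrite pmulr_lgt0 ?subr_gt0.
  by have : (v - u) * (4 - u) <= 0; [apply: mulr_ge0_le0; lra|lra].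
rewrite ltNge; apply/negP => pu.
have h : 0 < (p - u) * (q - u) by rewrite -E mulr_gt0//; lra.
have : (p - u) * (q - u) <= 0 by apply: mulr_le0_ge0; lra.
lra.
Qed.

Let r2_bnd s : 0 < s < pi ->
  [/\ 0 < r2 s, r2 s < 4, r2 s < (1 + x) ^+ 2 & (1 - x) ^+ 2 < r2 s].
Proof.
move=> /cos_oo/andP[c1 c2].
have k2 : 0 < k ^+ 2 by rewrite exprn_gt0.
have y2 : 0 < 2 * y by rewrite mulr_gt0.
have lo : (1 - x) ^+ 2 < r2 s.
  rewrite low_root /r2 ltr_pM2l//.
  by move: y_gt0 => y0; nra.
have : r2 s < k ^+ 2 * (1 + y) ^+ 2.
  by rewrite /r2 ltr_pM2l//; move: y_gt0 => y0; nra.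
rewrite upper => /andP[h4 hx]; split=> //.
by apply: le_lt_trans lo; exact: sqr_ge0.
Qed.

Let heron_r2 r : heron r x = ((1 + x) ^+ 2 - r ^+ 2) * (r ^+ 2 - (1 - x) ^+ 2).
Proof. by rewrite /heron; ring. Qed.

Let dturn (s : R) : R :=
  k ^+ 2 * y * sin s / (pi * (Num.sqrt (r2 s) * Num.sqrt (4 - r2 s))).

Let half_lt1 s : 0 < s < pi -> 0 < Num.sqrt (r2 s) / 2 < 1.
Proof.
move=> /r2_bnd[h1 h2 _ _]; rewrite divr_gt0 ?sqrtr_gt0//=.
rewrite ltr_pdivrMr// mul1r -(@ltr_pXn2r _ 2) ?qualifE/= ?sqrtr_ge0//.
by rewrite sqr_sqrtr ?(ltW h1)// (_ : 2 ^+ 2 = 4)//; ring.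
Qed.

Let is_derive_turn s : 0 < s < pi -> is_derive s 1 turn (dturn s).
Proof.
move=> s0; have [h1 h2 h3 h4] := r2_bnd s0.
have /andP[u0 u1] := half_lt1 s0.
have pi0 := pi_gt0 R.
rewrite /turn; derive.
  notypeclasses refine (is_derive_comp _ _).
    by apply: is_derive1_acos; rewrite u1 (lt_trans _ u0)// oppr_lt0.
  derive_rec; first exact: h1.
  by rewrite /r2; derive_rec.
have -> : 1 - (Num.sqrt (r2 s) / 2) ^+ 2 = (4 - r2 s) / 2 ^+ 2.
  by rewrite exprMn sqr_sqrtr ?ltW//; field.
rewrite sqrtrM ?subr_ge0 ?(ltW h2)// sqrtrV ?sqr_ge0// sqrtr_sqr ger0_norm//.
rewrite /dturn.
have a0 : Num.sqrt (4 - r2 s) != 0 by rewrite gt_eqF// sqrtr_gt0 subr_gt0.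
have b0 : Num.sqrt (r2 s) != 0 by rewrite gt_eqF// sqrtr_gt0.
move: a0 b0; set a := Num.sqrt _; set b := Num.sqrt _ => a0 b0.
move: (pi : R) pi0 => p p0.
by field; rewrite a0 b0 (gt_eqF p0).
Qed.

Let cos_turn s : 0 < s < pi -> 2 * cos (pi * turn s) = Num.sqrt (r2 s).
Proof.
move=> /half_lt1/andP[u0 u1].
rewrite /turn (mulrC pi) divfK ?gt_eqF ?pi_gt0// acosK; first by field.
by rewrite in_itv/= (ltW u1) andbT (le_trans _ (ltW u0))// oppr_le0.
Qed.

(** The product of [r^2 (4 - r^2)] and of [heron] is a square times [walk_quartic]: the factors
    [1 - cos s] and [1 + cos s] of the two bounds for [r^2] combine to [sin s ^ 2] and cancel against
    [dturn]. *)
Let kernel_turn s : 0 < s < pi ->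
  side_kernel (2 * cos (pi * turn s)) x * dturn s =
  x / (pi * k ^+ 2) * walk_kernel y (cos s).
Proof.
move=> s0; have [h1 h2 h3 h4] := r2_bnd s0.
have pi0 := pi_gt0 R.
have z0 := sin_gt0_pi s0.
rewrite cos_turn// /side_kernel /dturn gtr0_norm// heron_r2 sqr_sqrtr ?(ltW h1)//.
set A := r2 s in h1 h2 h3 h4 *.
have q0 : 0 < walk_quartic y (cos s).
  apply: walk_quartic_gt0; first by rewrite gtr0_norm.
  by rewrite cos_geN1 cos_le1.
have E : Num.sqrt A * Num.sqrt (4 - A) * Num.sqrt (((1 + x) ^+ 2 - A) * (A - (1 - x) ^+ 2)) =
    k ^+ 4 * (2 * y * sin s) * Num.sqrt (walk_quartic y (cos s)).
  have sqrt3 (a b e : R) : 0 <= a -> 0 <= b ->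
      Num.sqrt a * Num.sqrt b * Num.sqrt e = Num.sqrt (a * b * e).
    by move=> a0 b0; rewrite -!sqrtrM ?mulr_ge0.
  rewrite sqrt3 ?(ltW h1) ?subr_ge0 ?(ltW h2)//.
  have -> : k ^+ 4 * (2 * y * sin s) = Num.sqrt ((k ^+ 4 * (2 * y * sin s)) ^+ 2).
    by rewrite sqrtr_sqr ger0_norm// !mulr_ge0// ?exprn_ge0 ?ltW.
  rewrite -sqrtrM ?sqr_ge0//; congr Num.sqrt.
  have -> : A * (4 - A) * (((1 + x) ^+ 2 - A) * (A - (1 - x) ^+ 2)) =
     A * (((1 + x) ^+ 2 - A) * (4 - A)) * (A - (1 - x) ^+ 2) by ring.
  rewrite roots low_root.
  have -> : (k ^+ 4 * (2 * y * sin s)) ^+ 2 = k ^+ 8 * (4 * y ^+ 2) * (sin s) ^+ 2 by ring.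
  by rewrite sin2cos2 /A /r2 /walk_quartic; ring.
move: E; rewrite /walk_kernel.
have : Num.sqrt A != 0 by rewrite gt_eqF// sqrtr_gt0.
have : Num.sqrt (4 - A) != 0 by rewrite gt_eqF// sqrtr_gt0 subr_gt0.
have : Num.sqrt (((1 + x) ^+ 2 - A) * (A - (1 - x) ^+ 2)) != 0.
  by rewrite gt_eqF// sqrtr_gt0 mulr_gt0// subr_gt0.
have : Num.sqrt (walk_quartic y (cos s)) != 0 by rewrite gt_eqF// sqrtr_gt0.
set q := Num.sqrt (walk_quartic _ _); set d := Num.sqrt (_ * _).
set a := Num.sqrt A; set b := Num.sqrt (4 - A) => qn dn bn an E.
move: (pi : R) pi0 => p p0.
transitivity (2 * x * k ^+ 2 * y * sin s / (p * (a * b * d))).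
  by field; rewrite an bn dn (gt_eqF p0).
by rewrite E; field; rewrite qn (gt_eqF p0) (gt_eqF z0) (gt_eqF y_gt0) (gt_eqF k_gt0).
Qed.

Let image_turn : turn @` `]0, pi[ =
  [set z | 0 < z < 1 / 2 /\ 0 < heron (2 * cos (pi * z)) x].
Proof.
have pi0 := pi_gt0 R.
apply/seteqP; split => [_ [s /= + <-]|z /= [z01]].
  rewrite in_itv/= => s0; have [h1 h2 h3 h4] := r2_bnd s0.
  rewrite cos_turn// heron_r2 sqr_sqrtr ?(ltW h1)//.
  split; last by rewrite mulr_gt0 ?subr_gt0.
  have /andP[u0 u1] := half_lt1 s0.
  have u2 : -1 < Num.sqrt (r2 s) / 2 < 1 by rewrite u1 (lt_trans _ u0)// oppr_lt0.
  have /andP[a0 _] := acos_oo u2.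
  rewrite /turn divr_gt0//= ltr_pdivrMr// (_ : 1 / 2 * pi = pi / 2); last by rewrite mul1r mulrC.
  have uc : -1 <= Num.sqrt (r2 s) / 2 <= 1 by case/andP: u2 => *; rewrite !ltW.
  have aI : acos (Num.sqrt (r2 s) / 2) \in `[0, pi] by rewrite in_itv/= acos_ge0 ?acos_lepi.
  have piI : pi / 2 \in `[0, pi : R].
    by rewrite in_itv/= divr_ge0 ?pi_ge0//= ler_pdivrMr// ler_pMr// ler1n.
  by rewrite -(ltr_cos aI piI) cos_pihalf acosK ?in_itv.
have [z0 z1] := andP z01.
have zpi : 0 < pi * z < pi by rewrite mulr_gt0//= gtr_pMr//; lra.
have /andP[c1 c2] := cos_oo zpi.
have c0 : 0 < cos (pi * z).
  apply: cos_gt0_pihalf; rewrite (@lt_trans _ _ 0) ?oppr_lt0 ?divr_gt0//=; last by case/andP: zpi.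
  by rewrite ltr_pM2l// -div1r.
rewrite heron_r2; set r := 2 * cos (pi * z) => h0.
have r0 : 0 < r by rewrite mulr_gt0.
have r4 : r ^+ 2 < 4.
  have r_lt2 : r < 2 by rewrite /r; lra.
  by rewrite (_ : 4 = 2 ^+ 2 :> R); [rewrite ltr_pXn2r ?qualifE/= ?(ltW r0)|ring].
have [rx xr] : r ^+ 2 < (1 + x) ^+ 2 /\ (1 - x) ^+ 2 < r ^+ 2.
  have x0 := x_gt0.
  have [h1|h1] := ltP (r ^+ 2) ((1 + x) ^+ 2).
    by split=> //; move: h0; rewrite pmulr_rgt0 ?subr_gt0.
  exfalso; have : ((1 + x) ^+ 2 - r ^+ 2) * (r ^+ 2 - (1 - x) ^+ 2) <= 0.
    by apply: mulr_le0_ge0; nra.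
  by rewrite leNgt h0.
have k2 : 0 < k ^+ 2 by rewrite exprn_gt0.
have ry : r ^+ 2 < k ^+ 2 * (1 + y) ^+ 2 by rewrite upper r4.
pose c := (r ^+ 2 / k ^+ 2 - 1 - y ^+ 2) / (2 * y).
have y2 : 0 < 2 * y by rewrite mulr_gt0.
have c1' : -1 < c < 1.
  rewrite /c ltr_pdivlMr// ltr_pdivrMr//; apply/andP; split.
    rewrite -subr_gt0 (_ : _ - _ = (r ^+ 2 - k ^+ 2 * (1 - y) ^+ 2) / k ^+ 2).
      by rewrite divr_gt0// subr_gt0 -low_root.
    by field; rewrite gt_eqF.
  rewrite -subr_gt0 (_ : _ - _ = (k ^+ 2 * (1 + y) ^+ 2 - r ^+ 2) / k ^+ 2).
    by rewrite divr_gt0// subr_gt0.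
  by field; rewrite gt_eqF.
exists (acos c); first by rewrite /= in_itv/= acos_oo.
rewrite /turn; have -> : r2 (acos c) = r ^+ 2.
  case/andP: c1' => ? ?; rewrite /r2 acosK ?in_itv/= ?ltW//.
  by rewrite /c; field; rewrite (gt_eqF y_gt0) (gt_eqF k_gt0).
rewrite sqrtr_sqr gtr0_norm// /r (mulrC 2) mulfK// cosK; last first.
  by case/andP: zpi => ? ?; rewrite in_itv/= !ltW.
by rewrite mulrC mulKf// gt_eqF.
Qed.

Lemma integral_second_step :
  (\int[mu]_(z in `]0%R, (1 / 2)%R[) (side_kernel (2 * cos (pi * z)) x)%:E =
   (x / (pi * k ^+ 2) * walk_integral y)%:E)%E.
Proof.
transitivity (\int[mu]_(z in turn @` `]0%R, pi[) (side_kernel (2 * cos (pi * z)) x)%:E)%E.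
  rewrite image_turn.
  have -> : [set z | 0 < z < 1 / 2 /\ 0 < heron (2 * cos (pi * z)) x] =
     `]0, 1 / 2[ `&` [set z | 0 < heron (2 * cos (pi * z)) x].
    by apply/seteqP; split => z; rewrite /= in_itv.
  rewrite integral_mkcondr; apply: eq_integral => z _.
  rewrite patchE; case: ifPn => //; rewrite notin_setE/= => /negP h.
  by rewrite side_kernel_le0// leNgt.
have dF s (s0 : 0 < s < pi) : is_derive s 1 turn (dturn s) by exact: is_derive_turn.
have dturn_gt0 s : 0 < s < pi -> 0 < dturn s.
  move=> s0; have [h1 h2 _ _] := r2_bnd s0; have z0 := sin_gt0_pi s0.
  apply: divr_gt0; first by rewrite !mulr_gt0// exprn_gt0.
  by rewrite !mulr_gt0 ?pi_gt0 ?sqrtr_gt0 ?subr_gt0.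
have cdturn s : 0 < s < pi -> {for s, continuous dturn}.
  move=> s0; have [h1 h2 _ _] := r2_bnd s0.
  notypeclasses refine (is_derive_continuous _); rewrite /dturn; derive_rec.
  - by rewrite gt_eqF// !mulr_gt0 ?pi_gt0 ?sqrtr_gt0 ?subr_gt0.
  - exact: h1.
  - by rewrite /r2; derive_rec.
  - by rewrite subr_gt0.
  - by rewrite /r2; derive_rec.
have ckernel s : 0 < s < pi ->
    {for turn s, continuous (fun z => side_kernel (2 * cos (pi * z)) x)}.
  move=> s0; have [h1 h2 h3 h4] := r2_bnd s0.
  notypeclasses refine (is_derive_continuous _); rewrite /side_kernel; derive_rec.
    by rewrite cos_turn// heron_r2 sqr_sqrtr ?(ltW h1)// mulr_gt0 ?subr_gt0.
  by rewrite /heron; derive_rec.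
have kernel_ge0 s : 0 < s < pi -> 0 <= side_kernel (2 * cos (pi * turn s)) x.
  by move=> _; exact: side_kernel_ge0.
rewrite (ge0_substitution_open (pi_gt0 R) dF dturn_gt0 cdturn ckernel kernel_ge0).
transitivity (\int[mu]_(s in `]0%R, pi[) (x / (pi * k ^+ 2) * walk_kernel y (cos s))%:E)%E.
  by apply: eq_integral => s; rewrite inE/= in_itv/= => s0; rewrite kernel_turn.
have cw : {within `[0, pi], continuous (fun s => walk_kernel y (cos s))}.
  by apply: continuous_walk_kernel; rewrite gtr0_norm.
have mw : measurable_fun (`]0, pi[ : set R) (fun s => walk_kernel y (cos s)).
  apply: (measurable_funS (E := `[0, pi])) => //; first exact: subset_itv_oo_cc.
  exact: subspace_continuous_measurable_fun.
have w0 (s : R) : 0 <= walk_kernel y (cos s) by rewrite invr_ge0 sqrtr_ge0.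
under eq_integral do rewrite EFinM.
rewrite ge0_integralZl//; last 3 first.
- exact/measurable_EFinP.
- by move=> s _; rewrite lee_fin.
- by rewrite lee_fin divr_ge0 ?mulr_ge0 ?exprn_ge0 ?pi_ge0 ?ltW.
rewrite -(@integral_itv_bndoo _ _ _ _ true false); last exact/measurable_EFinP.
rewrite [RHS]EFinM; congr (_ * _)%E.
rewrite /walk_integral /Rintegral fineK//.
by apply: integrable_fin_num => //; exact: continuous_segment_integrable.
Qed.

End SecondStep.

(** * The density of the walk *)

Section WalkDensity.
Context {R : realType}.
Notation mu := (@lebesgue_measure R).
Notation Rm := (measurableTypeR R).

(** The involution [x -> (3 - x) / (1 + x)] exchanges [0, 1) and (1, 3] and preserves the modulus. *)
Lemma walk_gauss_involution (x : R) : 0 <= x ->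
  walk_gauss ((3 - x) / (1 + x)) = ((1 + x) / 2) ^+ 2 * walk_gauss x.
Proof.
move=> x0; have x1 : 1 + x != 0 by rewrite gt_eqF// ltr_pwDl.
have x3 : 3 + x ^+ 2 != 0 by rewrite gt_eqF// ltr_pwDl ?sqr_ge0.
have y3 : 3 + ((3 - x) / (1 + x)) ^+ 2 = 4 * (3 + x ^+ 2) / (1 + x) ^+ 2 by field.
rewrite /walk_gauss.
have -> : walk_modulus ((3 - x) / (1 + x)) = walk_modulus x.
  by rewrite /walk_modulus y3; field; rewrite x1 x3.
by rewrite y3; field; rewrite x1 x3.
Qed.

Lemma integral_distances (x : R) : 0 < x < 3 -> x != 1 ->
  (\int[mu]_(z in `]0%R, (1 / 2)%R[) (side_kernel (2 * cos (pi * z)) x)%:E =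
   (x / Num.sqrt 3 * walk_gauss x)%:E)%E.
Proof.
move=> /andP[x0 x3] xn1; have pi0 := pi_gt0 R.
have s3 : Num.sqrt 3 != 0 :> R by rewrite gt_eqF// sqrtr_gt0.
have [x1|x1] := ltP x 1.
  rewrite (@integral_second_step _ x x 1)//; try ring.
  rewrite walk_integralE ?(ltW x0)//; congr (_%:E).
  by move: (pi : R) pi0 => p p0; field; rewrite s3 (gt_eqF p0).
have {xn1}x1 : 1 < x by rewrite lt_neqAle eq_sym xn1.
have xp : 0 < 1 + x by lra.
have xp0 : 1 + x != 0 by rewrite gt_eqF.
have y0 : 0 < (3 - x) / (1 + x) by rewrite divr_gt0// subr_gt0.
have y1 : (3 - x) / (1 + x) < 1 by rewrite ltr_pdivrMr//; lra.
rewrite (@integral_second_step _ x ((3 - x) / (1 + x)) ((1 + x) / 2))//;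
  [|by rewrite divr_gt0|by field|by field|by field].
rewrite walk_integralE ?(ltW y0)// walk_gauss_involution ?(ltW x0)//; congr (_%:E).
by move: (pi : R) pi0 => p p0; field; rewrite s3 xp0 (gt_eqF p0).
Qed.

Let measurable_heron : measurable_fun setT (fun v : Rm * Rm => heron v.1 v.2 : Rm).
Proof.
have m1 : measurable_fun setT (fun v : Rm * Rm => v.1) := measurable_fst.
have m2 : measurable_fun setT (fun v : Rm * Rm => v.2) := measurable_snd.
rewrite /heron; apply: measurable_funM.
- apply: measurable_funB; apply: measurable_funX => //.
  by apply: measurable_funD.
- apply: measurable_funB; apply: measurable_funX => //.
  by apply: measurable_funB.
Qed.

Lemma measurable_side_kernel :
  measurable_fun setT (fun v : Rm * Rm => side_kernel (2 * cos (pi * v.1)) v.2 : Rm).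
Proof.
have m1 : measurable_fun setT (fun v : Rm * Rm => 2 * cos (pi * v.1) : Rm).
  apply: measurable_funM => //.
  apply: (measurableT_comp (continuous_measurable_fun (@continuous_cos R))).
  by apply: measurable_funM => //; exact: measurable_fst.
have m2 : measurable_fun setT (fun v : Rm * Rm => v.2) := measurable_snd.
have mh : measurable_fun setT (fun v : Rm * Rm => heron (2 * cos (pi * v.1)) v.2 : Rm).
  have m12 : measurable_fun setT (fun v : Rm * Rm => ((2 * cos (pi * v.1) : Rm), v.2)).
    exact/measurable_fun_pair.
  exact: (measurableT_comp measurable_heron m12).
rewrite /side_kernel; apply: measurable_funM.
  apply: measurable_funM => //.
  exact: (measurableT_comp (continuous_measurable_fun (@norm_continuous _ R)) m2).
rewrite (_ : (fun v => _) =
    (fun v => (Num.sqrt (heron (2 * cos (pi * v.1)) v.2)) `^ (-1))); last first.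
  by apply/funext => v; rewrite powR_inv1// sqrtr_ge0.
apply: (measurableT_comp (measurable_powR (-1))).
exact: (measurableT_comp (continuous_measurable_fun (@sqrt_continuous R))).
Qed.

Lemma ge0_fubini_on (A B : set Rm) (f : Rm * Rm -> \bar R) :
  measurable A -> measurable B -> measurable_fun setT f -> (forall v, 0 <= f v)%E ->
  (\int[mu]_(x in A) \int[mu]_(y in B) f (x, y) =
   \int[mu]_(y in B) \int[mu]_(x in A) f (x, y))%E.
Proof.
move=> mA mB mf f0.
pose h := f \_ (A `*` B).
have mh : measurable_fun setT h.
  apply/(measurable_restrictT f); first exact: measurableX.
  exact: measurable_funTS.
have h0 v : (0 <= h v)%E by rewrite erestrict_ge0.
transitivity (\int[mu]_x \int[mu]_y h (x, y))%E.
  rewrite integral_mkcond; apply: eq_integral => x _; rewrite patchE.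
  case: ifPn => xA.
    rewrite integral_mkcond; apply: eq_integral => y _.
    by rewrite /h !patchE in_setX/= xA.
  rewrite (eq_integral (cst 0%E)) ?integral0// => y _.
  by rewrite /h patchE in_setX/= (negbTE xA).
rewrite fubini_tonelli// [RHS]integral_mkcond; apply: eq_integral => y _.
rewrite patchE; case: ifPn => yB.
  rewrite [RHS]integral_mkcond; apply: eq_integral => x _.
  by rewrite /h !patchE in_setX/= yB andbT.
rewrite (eq_integral (cst 0%E)) ?integral0// => x _.
by rewrite /h patchE in_setX/= (negbTE yB) andbF.
Qed.

Lemma triangle_law (a b : R) : 0 <= a -> 0 <= b ->
  (4%:E * \int[mu]_(z in `]0%R, (1 / 2)%R[) \int[mu]_(y in `]0%R, (1 / 2)%R[)
     (\1_(`]a ^+ 2, b ^+ 2[%classic) (triangle_sqr z y))%:E =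
   4%:E * \int[mu]_(x in `]a, b[) \int[mu]_(z in `]0%R, (1 / 2)%R[)
     (side_kernel (2 * cos (pi * z)) x / (2 * pi))%:E)%E.
Proof.
move=> a0 b0; have pi0 := pi_gt0 R.
congr (_ * _)%E.
transitivity (\int[mu]_(z in `]0%R, (1 / 2)%R[) \int[mu]_(x in `]a, b[)
    (side_kernel (2 * cos (pi * z)) x / (2 * pi))%:E)%E.
  apply: eq_integral => z; rewrite inE/= in_itv/= => /andP[z0 z1].
  rewrite -integral_third_side// mulr_gt0// cos_gt0_pihalf//.
  rewrite (@lt_trans _ _ 0) ?oppr_lt0 ?divr_gt0 ?mulr_gt0//=.
  by rewrite ltr_pM2l// -div1r.
rewrite (@ge0_fubini_on _ _ (fun v => (side_kernel (2 * cos (pi * v.1)) v.2 / (2 * pi))%:E))//; last 2 first.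
- apply/measurable_EFinP; apply: measurable_funM => //.
  exact: measurable_side_kernel.
- by move=> v; rewrite lee_fin divr_ge0 ?side_kernel_ge0// mulr_ge0// ltW.
Qed.

Context {d : measure_display} {T : measurableType d} {P : probability T R}.
Context {U : 'I_3 -> {RV P >-> R}}.
Hypothesis indepU : mutually_independent U.
Hypothesis unifU : forall k : 'I_3, uniformly_distributed01 (U k).

Definition squared_distance (w : T) : R :=
  walk_sqr (U (@Ordinal 3 2 isT) w) (U (@Ordinal 3 1 isT) w) (U ord0 w).

Local Notation V := squared_distance.

Lemma walk_distanceE w : 0 <= V w /\ walk_distance U w = Num.sqrt (V w).
Proof.
suff VE : V w = complex.Re (\sum_(k < 3) expi (2 * pi * U k w)) ^+ 2
              + complex.Im (\sum_(k < 3) expi (2 * pi * U k w)) ^+ 2.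
  by split; [rewrite VE addr_ge0 ?sqr_ge0|rewrite VE /walk_distance normc_def].
rewrite !big_ord_recl big_ord0 addr0.
have -> : lift ord0 (lift ord0 ord0) = @Ordinal 3 2 isT by exact: val_inj.
have -> : lift ord0 ord0 = @Ordinal 3 1 isT :> 'I_3 by exact: val_inj.
rewrite /V /walk_sqr /cos1 !mulrBr /expi /=.
set p := 2 * pi * U ord0 w; set q := 2 * pi * U (Ordinal _) w; set r := 2 * pi * _.
have cp := cos2Dsin2 p; have cq := cos2Dsin2 q; have cr := cos2Dsin2 r.
clearbody p q r; rewrite !cosB.
have -> : 3 = (cos p ^+ 2 + sin p ^+ 2) + (cos q ^+ 2 + sin q ^+ 2) + (cos r ^+ 2 + sin r ^+ 2) :> R.
  by rewrite cp cq cr; ring.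
by ring.
Qed.

Lemma walk_law (a b : R) : 0 <= a -> 0 <= b ->
  (P (walk_distance U @^-1` `]a, b[) =
   4%:E * \int[mu]_(x in `]a, b[) \int[mu]_(z in `]0%R, (1 / 2)%R[)
     (side_kernel (2 * cos (pi * z)) x / (2 * pi))%:E)%E.
Proof.
move=> a0 b0; rewrite -triangle_law//.
pose g : R -> \bar R := EFin \o \1_(`]a ^+ 2, b ^+ 2[%classic).
have mg : measurable_fun setT g by apply/measurable_EFinP; exact: measurable_indic.
have g0 t : (0 <= g t)%E by rewrite lee_fin.
rewrite -[RHS]/(4%:E * \int[mu]_(z in `]0%R, (1 / 2)%R[) \int[mu]_(y in `]0%R, (1 / 2)%R[)
     g (triangle_sqr z y))%E.
rewrite -(two_angles mg g0).
rewrite -(joint_integral indepU unifU (f := fun v => g (walk_sqr v.1 v.2.1 v.2.2)))//; last first.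
  exact: (measurableT_comp mg (@measurable_walk_sqr R)).
have mV : measurable_fun setT (V : T -> Rm).
  have m k : measurable_fun setT (U k : T -> Rm) by exact: (measurable_funP (U k)).
  have m3 : measurable_fun setT (fun w => (U (@Ordinal 3 2 isT) w : Rm,
      (U (@Ordinal 3 1 isT) w : Rm, U ord0 w : Rm))).
    by apply/measurable_fun_pair => //; apply/measurable_fun_pair.
  exact: (measurableT_comp (@measurable_walk_sqr R) m3).
have -> : walk_distance U @^-1` `]a, b[ = V @^-1` `]a ^+ 2, b ^+ 2[.
  apply/seteqP; split => w /=; rewrite !in_itv/=; have [V0 ->] := walk_distanceE w.
    by move=> /andP[h1 h2]; rewrite -[V w]sqr_sqrtr// !ltr_pXn2r ?qualifE/= ?sqrtr_ge0// h1.
  by rewrite -[V w in X in X -> _]sqr_sqrtr// !ltr_pXn2r ?qualifE/= ?sqrtr_ge0.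
have mVab : measurable (V @^-1` `]a ^+ 2, b ^+ 2[).
  by rewrite -[X in measurable X]setTI; apply: mV => //; exact: measurable_itv.
by rewrite -[X in P X]setIT -integral_indic.
Qed.

End WalkDensity.

(** * Comparison of densities *)

Section CompareDensities.
Context {R : realType}.
Notation mu := (@lebesgue_measure R).

(** If [p x < q x], then near [x] in [S] the values of [p] lie below those of [q] by a fixed amount,
    and so do the means over short intervals. The intervals may lie on one side of [x], so that [x] may
    be an endpoint of [S]. *)
Lemma le_of_integral_eq (S : set R) (p q : R -> R) (x : R) : S x ->
  {within S, continuous p} -> {within S, continuous q} ->
  (forall t, S t -> 0 <= p t) -> (forall t, S t -> 0 <= q t) ->
  (forall e, 0 < e -> exists a b, [/\ a < b, `]a, b[ `<=` S `&` ball x e &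
     (\int[mu]_(t in `]a, b[) (p t)%:E = \int[mu]_(t in `]a, b[) (q t)%:E)%E]) ->
  q x <= p x.
Proof.
move=> Sx cp cq p0 q0 pq; rewrite leNgt; apply/negP => px.
pose D := (q x - p x) / 4.
have D0 : 0 < D by rewrite divr_gt0// subr_gt0.
have /subspace_continuousP/(_ _ Sx)/cvgrPdist_lt/(_ _ D0) := cp.
have /subspace_continuousP/(_ _ Sx)/cvgrPdist_lt/(_ _ D0) := cq.
move=> /nbhs_ballP[e1 /= e10 h1] /nbhs_ballP[e2 /= e20 h2].
have [a [b [ab abS pqE]]] := pq (Num.min e1 e2) ltac:(by rewrite lt_min e10).
have abE t : `]a, b[%classic t -> [/\ S t, p t <= p x + D & q x - D <= q t].
  move=> /abS[St xt]; split=> //.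
    have := h2 t (le_ball _ xt) St; rewrite ge_min lexx orbT => /(_ isT).
    by rewrite ltr_distlC => /andP[_ /ltW].
  have := h1 t (le_ball _ xt) St; rewrite ge_min lexx => /(_ isT).
  by rewrite ltr_distlC => /andP[/ltW].
have sub : `]a, b[ `<=` S by move=> t /abE[].
have mS (f : R -> R) : {within S, continuous f} -> measurable_fun (`]a, b[ : set R) f.
  move=> cf; apply: subspace_continuous_measurable_fun => //.
  exact: continuous_subspaceW cf.
have mab : mu `]a, b[ = (b - a)%:E.
  by rewrite lebesgue_measure_itv/= lte_fin ab.
have h3 : (\int[mu]_(t in `]a, b[) (p t)%:E <= (p x + D)%:E * (b - a)%:E)%E.
  rewrite -mab -integral_cst//; apply: ge0_le_integral => //.
  - by move=> t /sub/p0; rewrite lee_fin.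
  - by apply/measurable_EFinP; exact: mS.
  - by move=> t /abE[_ + _]; rewrite lee_fin.
have h4 : ((q x - D)%:E * (b - a)%:E <= \int[mu]_(t in `]a, b[) (q t)%:E)%E.
  rewrite -mab -integral_cst//; apply: ge0_le_integral => //.
  - move=> t _; rewrite lee_fin /D; have := p0 _ Sx; lra.
  - by apply/measurable_EFinP; exact: mS.
  - by move=> t /abE[_ _]; rewrite lee_fin.
rewrite -pqE in h4; have := le_trans h4 h3.
rewrite -!EFinM lee_fin ler_pM2r ?subr_gt0//.
by move: D0; rewrite /D; lra.
Qed.

End CompareDensities.

Section ClosedForm.
Context {R : realType}.
Notation mu := (@lebesgue_measure R).

Definition walk_density (x : R) : R :=
  2 * Num.sqrt 3 / pi * (x / (3 + x ^+ 2)) *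
  hypergeometric2F1 (1 / 3) (2 / 3) 1 (walk_modulus x).

Lemma walk_densityE (x : R) :
  walk_density x = 4 * (x / Num.sqrt 3 * walk_gauss x / (2 * pi)).
Proof.
rewrite /walk_density /walk_gauss; set f := hypergeometric2F1 _ _ _ _.
have x3 : 3 + x ^+ 2 != 0 by rewrite gt_eqF// ltr_pwDl ?sqr_ge0.
have s3 : Num.sqrt 3 ^+ 2 = 3 :> R by rewrite sqr_sqrtr.
have s0 : Num.sqrt 3 != 0 :> R by rewrite gt_eqF// sqrtr_gt0.
have p0 := pi_gt0 R; move: (pi : R) p0 => p p0.
move: s3 s0; set s := Num.sqrt 3 => s3 s0.
transitivity (2 * (x / (3 + x ^+ 2)) * f * s ^+ 2 / (p * s)).
  by field; rewrite s0 x3 (gt_eqF p0).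
by rewrite s3; field; rewrite s0 x3 (gt_eqF p0).
Qed.

Lemma walk_density_ge0 (x : R) : 0 <= x -> x != 1 -> 0 <= walk_density x.
Proof.
move=> x0 x1; rewrite /walk_density.
have x21 : x ^+ 2 != 1 by rewrite -(expr1n R 2) eqrXn2.
rewrite !mulr_ge0 ?invr_ge0 ?sqrtr_ge0 ?pi_ge0 ?addr_ge0 ?sqr_ge0//.
apply/ltW/hypergeometric2F1_gt0; try lra.
by rewrite walk_modulus_ge0 walk_modulus_lt1.
Qed.

Lemma continuous_walk_density (x : R) : x ^+ 2 != 1 -> {for x, continuous walk_density}.
Proof.
move=> x1.
have [dF FE] := @gauss_equation R (1 / 3) (2 / 3) ltac:(lra) ltac:(lra) ltac:(lra).
have z1 : `|walk_modulus x| < 1 by rewrite ger0_norm ?walk_modulus_ge0 ?walk_modulus_lt1.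
have [F1 _] := FE _ z1.
have x3 : 3 + x ^+ 2 != 0 by rewrite gt_eqF// ltr_pwDl ?sqr_ge0.
notypeclasses refine (is_derive_continuous _); rewrite /walk_density; derive_rec.
  exact: x3.
notypeclasses refine (is_derive_comp F1 _); rewrite /walk_modulus; derive_rec.
by rewrite expf_neq0.
Qed.

Context {d : measure_display} {T : measurableType d} {P : probability T R}.
Context {U : 'I_3 -> {RV P >-> R}}.
Hypothesis indepU : mutually_independent U.
Hypothesis unifU : forall k : 'I_3, uniformly_distributed01 (U k).

Lemma walk_density_law (a b : R) : 0 <= a -> 0 <= b ->
  (forall t, a < t < b -> 0 < t < 3 /\ t != 1) ->
  P (walk_distance U @^-1` `]a, b[) = (\int[mu]_(t in `]a, b[) (walk_density t)%:E)%E.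
Proof.
move=> a0 b0 ab; rewrite walk_law//.
have tab (t : R) : `]a, b[%classic t -> 0 < t < 3 /\ t != 1 by rewrite /= in_itv; exact: ab.
have gE (t : R) : `]a, b[%classic t ->
   (\int[mu]_(z in `]0%R, (1 / 2)%R[) (side_kernel (2 * cos (pi * z)) t / (2 * pi))%:E =
    (walk_density t / 4)%:E)%E.
  move=> /tab[t03 t1].
  under eq_integral do rewrite mulrC EFinM.
  rewrite ge0_integralZl//.
  - rewrite integral_distances// walk_densityE -EFinM; congr (_%:E).
    have p0 := pi_gt0 R; move: (pi : R) p0 => p p0.
    have s0 : Num.sqrt 3 != 0 :> R by rewrite gt_eqF// sqrtr_gt0.
    by field; rewrite s0 (gt_eqF p0).
  - apply/measurable_EFinP/measurable_funTS.
    exact: (measurableT_comp (@measurable_side_kernel R) (measurable_pair2 t)).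
  - by move=> z _; rewrite lee_fin side_kernel_ge0.
  - by rewrite lee_fin invr_ge0 mulr_ge0 ?pi_ge0.
have q0 (t : R) : `]a, b[%classic t -> 0 <= walk_density t.
  by move=> /tab[/andP[t0 _] t1]; rewrite walk_density_ge0 ?ltW.
transitivity (4%:E * \int[mu]_(t in `]a, b[) (walk_density t / 4)%:E)%E.
  by congr (_ * _)%E; apply: eq_integral => t; rewrite inE; exact: gE.
rewrite -ge0_integralZl//.
- by apply: eq_integral => t _; rewrite -EFinM mulrC divfK.
- apply/measurable_EFinP; apply: open_continuous_measurable_fun => //.
  move=> t; rewrite inE => /tab[/andP[t0 _] t1]; apply: cvgMr_tmp.
  by apply: continuous_walk_density; rewrite -(expr1n R 2) eqrXn2// ltW.
- by move=> t /q0 h; rewrite lee_fin divr_ge0.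
Qed.

End ClosedForm.

Theorem mainTheorem2 (R : realType) (d : measure_display)
  (T : measurableType d) (P : probability T R) (U : 'I_3 -> {RV P >-> R})
  (indepU : mutually_independent U)
  (unifU : forall k : 'I_3, uniformly_distributed01 (U k))
  (p3 : R -> R)
  (p3_density : is_radial_density P (walk_distance U) p3)
  (p3_continuous : {within `[0, 1[ `|` `]1, 3], continuous p3})
  (x : R) (x_ge0 : 0 <= x) (x_le3 : x <= 3) (x_neq1 : x <> 1) :
  p3 x = 2 * Num.sqrt 3 / pi * (x / (3 + x ^+ 2)) *
         hypergeometric2F1 (1 / 3) (2 / 3) 1
           (x ^+ 2 * (9 - x ^+ 2) ^+ 2 / (3 + x ^+ 2) ^+ 3).
Proof.
rewrite -/(walk_modulus x) -/(walk_density x).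
have [mp p_ge0 p_law] := p3_density.
pose S : set R := `[0, 1[ `|` `]1, 3].
have SE t : S t -> [/\ 0 <= t, t <= 3 & t != 1].
  by rewrite /S/= !in_itv/= => -[] /andP[h1 h2]; split; try lra; rewrite neq_lt ?h1 ?h2 ?orbT.
have Sx : S x.
  rewrite /S/= !in_itv/= x_ge0 x_le3 andbT /=.
  by have [h|h|//] := ltgtP x 1; [left|right].
have q_ge0 t : S t -> 0 <= walk_density t by move=> /SE[h1 _ h2]; exact: walk_density_ge0.
have cq : {within S, continuous (@walk_density R)}.
  apply: continuous_in_subspaceT => t; rewrite inE => /SE[h1 _ h2].
  by apply: continuous_walk_density; rewrite -(expr1n R 2) eqrXn2.
have p_ge0S t : S t -> 0 <= p3 t by move=> /SE[h _ _]; exact: p_ge0.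
have intervals e : 0 < e -> exists a b, [/\ a < b, `]a, b[ `<=` S `&` ball x e &
    (\int[lebesgue_measure]_(t in `]a, b[) (p3 t)%:E =
     \int[lebesgue_measure]_(t in `]a, b[) (walk_density t)%:E)%E].
  move=> e0.
  suff [a [b [a0 ab abS abx]]] : exists a b, [/\ 0 <= a, a < b, `]a, b[ `<=` S `&` ball x e
      & forall t, a < t < b -> 0 < t < 3 /\ t != 1].
    exists a, b; split=> //.
    have b0 : 0 <= b by rewrite (le_trans a0)// ltW.
    rewrite -(walk_density_law indepU unifU a0 b0 abx) p_law//.
    congr (integral _ _ _).
    apply/seteqP; split => t /=; last by case.
    rewrite !in_itv/= andbT => tab; split=> //.
    by case/andP: tab => /ltW h _; exact: le_trans h.
  case: Sx; rewrite /= in_itv/= => /andP[h1 h2].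
  - exists x, (Num.min (x + e) 1); split=> //.
    + by rewrite lt_min h2 ltrDl e0.
    + move=> t; rewrite /= in_itv/= lt_min => /andP[h3 /andP[h4 h5]]; split.
        by left; rewrite /= in_itv/= h5 ltW// (le_lt_trans h1).
      by rewrite /ball/= distrC ltr_distlC; lra.
    + by move=> t; rewrite lt_min => /andP[h3 /andP[h4 h5]]; split; [lra|rewrite lt_eqF].
  - exists (Num.max (x - e) 1), x; split=> //.
    + by rewrite le_max ler01 orbT.
    + by rewrite gt_max h1 gtrBl e0.
    + move=> t; rewrite /= in_itv/= gt_max => /andP[/andP[h3 h4] h5]; split.
        by right; rewrite /= in_itv/= h4 (le_trans (ltW h5)).
      by rewrite /ball/= ltr_distlC; lra.
    + by move=> t; rewrite gt_max => /andP[/andP[h3 h4] h5]; split; [lra|rewrite gt_eqF].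
apply/eqP; rewrite eq_le; apply/andP; split.
  apply: (@le_of_integral_eq _ S (@walk_density R) p3) => // e /intervals[a [b [h1 h2 h3]]].
  by exists a, b.
exact: (@le_of_integral_eq _ S p3 (@walk_density R)).
Qed.
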